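(* Let $\boldsymbol u\in [L^2_{\rm loc}(\mathbb{R}^3)]^3$ be such that the pair $(\boldsymbol u,p)$ with $p=-\frac{|\boldsymbol u|^2}{2}$ is a weak solution of the stationary Euler equations, i.e. \[ \int_{\mathbb{R}^3}\sum_{i,j=1}^3 u_i u_j\,\partial_j\varphi_i\,dx=-\int_{\mathbb{R}^3}p\,\nabla\cdot\boldsymbol\varphi\,dx\quad\text{for all }\boldsymbol\varphi\in[C^\infty_{\rm c}(\mathbb{R}^3)]^3 . \] Then \[ \int_{B_R}\frac{|\boldsymbol u_N|^2}{|x|}\,dx\le \frac{1}{2R}\int_{B_R}|\boldsymbol u|^2\,dx\quad\text{for all }0<R<+\infty . \] Moreover, if there exists a sequence $R_k\to+\infty$ such that \[ \int_{\partial B_{R_k}}|\boldsymbol u_T|^2\,dS\to 0\quad\text{as }k\to+\infty, \] then $\boldsymbol u\equiv 0$.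
   Context: $B_R$ denotes the open ball of radius $R$ centered at the origin in $\mathbb{R}^3$, and $dS$ the two-dimensional surface measure on $\partial B_R$. For a vector field $\boldsymbol u$ on $\mathbb{R}^3$, the normal and tangential parts are defined (a.e.) by $\boldsymbol u_N=\big(\boldsymbol u\cdot\frac{x}{|x|}\big)\frac{x}{|x|}$ and $\boldsymbol u_T=\boldsymbol u\times\frac{x}{|x|}$. A weak solution $(\boldsymbol u,p)\in[L^2_{\rm loc}(\mathbb{R}^3)]^3\times L^1_{\rm loc}(\mathbb{R}^3)$ satisfying $p=-\frac{|\boldsymbol u|^2}{2}$ a.e. is called a weak Beltrami flow.
   Formalization: Since u is only defined almost everywhere, the integrals over single spheres are not well defined; the hypothesis is taken as: for every null set N of radii there is a sequence R_k → +∞ avoiding N along which the integrals of |u_T|² tend to 0. ''u ≡ 0'' means almost everywhere. *)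

(* Defs.v *)
From mathcomp Require Import all_boot all_order all_algebra.
From mathcomp Require Import all_classical all_reals all_analysis.
Import Order.TTheory GRing.Theory Num.Theory numFieldNormedType.Exports.

Set Implicit Arguments.
Unset Strict Implicit.
Unset Printing Implicit Defensive.

Local Open Scope classical_set_scope.
Local Open Scope ring_scope.

Section Defs.
Variable R : realType.

Definition P3 := ((R * R) * R)%type.

Definition coord (i : 'I_3) (x : P3) : R :=
  match val i with 0%N => x.1.1 | 1%N => x.1.2 | _ => x.2 end.

Definition leb3 :=
  ((@lebesgue_measure R \x @lebesgue_measure R) \x @lebesgue_measure R)%E.

Definition norm3 (x : P3) : R := Num.sqrt (\sum_(i < 3) coord i x ^+ 2).

Definition ball3 (r : R) : set P3 := [set x | norm3 x < r].

Definition vfield := 'I_3 -> P3 -> R.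

Definition sqnorm (u : vfield) (x : P3) : R := \sum_(i < 3) u i x ^+ 2.

Definition e3 (j : 'I_3) : P3 :=
  ((if val j == 0%N then 1 else 0, if val j == 1%N then 1 else 0),
    if val j == 2%N then 1 else 0).

Definition partial (j : 'I_3) (f : P3 -> R) : P3 -> R := fun x => 'D_(e3 j) f x.

Fixpoint iter_partial (js : seq 'I_3) (f : P3 -> R) : P3 -> R :=
  if js is j :: js' then partial j (iter_partial js' f) else f.

Definition smooth3 (f : P3 -> R) : Prop :=
  forall js : seq 'I_3, continuous (iter_partial js f) /\
    forall (j : 'I_3) (x : P3), derivable (iter_partial js f) x (e3 j).

Definition test_field (phi : vfield) : Prop :=
  (forall i, smooth3 (phi i)) /\
  exists M : R, forall i x, M < norm3 x -> phi i x = 0.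

Definition div3 (phi : vfield) (x : P3) : R := \sum_(i < 3) partial i (phi i) x.

(* u in [L^2_loc(R^3)]^3 (with a Borel measurable representative). *)
Definition L2loc (u : vfield) : Prop :=
  forall i, measurable_fun setT (u i) /\
    forall r : R, 0 < r ->
      (\int[leb3]_(x in ball3 r) ((u i x) ^+ 2)%:E < +oo)%E.

Definition weak_euler (u : vfield) (p : P3 -> R) : Prop :=
  forall phi : vfield, test_field phi ->
    (\int[leb3]_x (\sum_(i < 3) \sum_(j < 3) u i x * u j x * partial j (phi i) x)%:E
     = - \int[leb3]_x (p x * div3 phi x)%:E)%E.

Definition normal_part (u : vfield) : vfield := fun i x =>
  (\sum_(k < 3) u k x * (coord k x / norm3 x)) * (coord i x / norm3 x).

Definition cross (a b : 'I_3 -> R) : 'I_3 -> R := fun i =>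
  match val i with
  | 0%N => a (inord 1) * b (inord 2) - a (inord 2) * b (inord 1)
  | 1%N => a (inord 2) * b (inord 0) - a (inord 0) * b (inord 2)
  | _ => a (inord 0) * b (inord 1) - a (inord 1) * b (inord 0)
  end.

Definition tangential_part (u : vfield) : vfield := fun i x =>
  cross (fun k => u k x) (fun k => coord k x / norm3 x) i.

Definition sph (r : R) (z : R * R) : P3 :=
  ((r * sin z.1 * cos z.2, r * sin z.1 * sin z.2), r * cos z.1).

(* Surface integral over dB_r: int_{dB_r} f dS, computed in spherical
   coordinates with surface element r^2 sin(theta) dtheta dphi. *)
Definition sphere_integral (r : R) (f : P3 -> R) : \bar R :=
  (\int[(@lebesgue_measure R \x @lebesgue_measure R)%E]_(z in
      (`[0%R, pi%R]%classic `*` `[0%R, (2 * pi)%R]%classic))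
     (f (sph r z) * r ^+ 2 * sin z.1)%:E)%E.

End Defs.

(* Main.v *)
From HB Require Import structures.
Require Import Defs.
From mathcomp Require Import all_boot all_order all_algebra.
From mathcomp Require Import all_classical all_reals all_analysis.
From mathcomp Require Import measurable_realfun ring lra.
Import Order.TTheory GRing.Theory Num.Theory numFieldNormedType.Exports.
Set Implicit Arguments.
Unset Strict Implicit.
Unset Printing Implicit Defensive.
Local Open Scope classical_set_scope.
Local Open Scope ring_scope.

(** Write [W = |u|^2], [A = (u.x)^2] and [F r] for the integral of [W] over the
ball [B_r].  Testing the equation with the field [x g(|x|^2)] gives
[int (W g / 2 + g' (W |x|^2 - 2 A)) = 0], and by approximation this persists for
[g = v] on [|x|^2 < r^2], [g = 0] outside, as soon as [v (r^2) = 0].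
- The choice [v t = (t + d)^(-1/2) - (r^2 + d)^(-1/2)] gives
  [int_{B_r} (d W + 2 A) (|x|^2 + d)^(-3/2) = (r^2 + d)^(-1/2) F r].
  Dropping [d W] and letting [d] tend to [0] yields the first claim; dropping
  [A] and taking [d = e^2] yields [c_e F e <= F r / r] for [e <= r].
- The choice [v t = t - r^2] gives [r^2 F r = int_{B_r} (3 W |x|^2 - 4 A)].
  Differentiating in spherical coordinates, for almost every [r] one gets
  [F r = r (int_{dB_r} |u_T|^2 - int_{dB_r} |u_N|^2) <= r int_{dB_r} |u_T|^2].
Along the given radii [F r / r] thus tends to [0], so [F e = 0] for all [e]. *)

(** * Spherical coordinates *)

(** The function [t^(-1/2)] solves [v/2 + t v' = 0]: it is the weight that removes [W] inside the
    ball and leaves only [A], while subtracting its value at [r^2] brings [F r] back. The shift [d]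
    keeps the test field smooth at the origin at the price of the term [d W], and that term is
    itself what lets [F r / r] control the energy of every smaller ball. No decay of [F r / r]
    follows from this; the linear weight supplies it, because its identity has constant coefficients
    in [W |x|^2] and [A], so that differentiating in [r] leaves only surface terms besides [F r].
    Two obstacles shape the rest. Test fields must be smooth to all orders, which is handled by
    inductive classes of functions closed under differentiation. Surface integrals must be linked to
    volume integrals, which is done by one-variable substitutions and Tonelli, followed by Lebesgue
    differentiation; the latter speaks only of almost every radius, hence the null sets [N] of radii
    in the theorem. *)

Section weighted_pushforward.
Local Open Scope ereal_scope.
Context d1 d2 (T1 : measurableType d1) (T2 : measurableType d2) (R : realType).
Variables (mu : {measure set T1 -> \bar R}) (phi : T1 -> T2) (w : T1 -> R).
Hypotheses (mphi : measurable_fun setT phi) (mw : measurable_fun setT w).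
Hypothesis w0 : forall x, (0 <= w x)%R.
Let mwE : measurable_fun setT (fun x => (w x)%:E).
Proof. exact/measurable_EFinP. Qed.

(* The proof arguments are unused: they let the measure structure be inferred. *)
Definition wpush of measurable_fun setT phi & measurable_fun setT w
  & (forall x, (0 <= w x)%R) := fun A : set T2 => \int[mu]_(x in phi @^-1` A) (w x)%:E.

Let wp := wpush mphi mw w0.

Let mpre A : measurable A -> measurable (phi @^-1` A).
Proof. by move=> mA; rewrite -(setTI (_ @^-1` _)); exact: mphi. Qed.

Let wp0 : wp set0 = 0.
Proof. by rewrite /wp /wpush preimage_set0 integral_set0. Qed.

Let wp_ge0 A : 0 <= wp A.
Proof. by apply: integral_ge0 => x _; rewrite lee_fin. Qed.

Let wp_sigma_additive : semi_sigma_additive wp.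
Proof.
move=> F mF tF mUF; rewrite /wp /wpush preimage_bigcup.
rewrite ge0_integral_bigcup//=.
- apply: is_cvg_ereal_nneg_natsum => n _; by apply: integral_ge0 => x _; rewrite lee_fin.
- by move=> k; exact: mpre.
- exact: measurable_funTS.
- by move=> x _; rewrite lee_fin.
- by move=> i j _ _ [x [Fi Fj]]; apply: tF => //; exists (phi x).
Qed.

HB.instance Definition _ := isMeasure.Build _ _ _ wp wp0 wp_ge0 wp_sigma_additive.

Definition wpush_measure : {measure set T2 -> \bar R} := wp.

Import HBNNSimple.

(** For an indicator this is the definition of [wpush]; sums over the values give simple functions,
    and both sides pass to the increasing limit of [nnsfun_approx] by monotone convergence. *)
Lemma ge0_integral_wpush (f : T2 -> \bar R) :
  measurable_fun setT f -> (forall y, 0 <= f y) ->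
  \int[wpush_measure]_y f y = \int[mu]_x (f (phi x) * (w x)%:E).
Proof.
move=> mf f0.
pose h := nnsfun_approx measurableT mf.
have hf y : (h n y)%:E @[n --> \oo] --> f y by exact: cvg_nnsfun_approx.
have -> : \int[wpush_measure]_y f y =
    limn (fun n => \int[wpush_measure]_y (h n y)%:E).
  rewrite -monotone_convergence//.
  - by apply: eq_integral => y _; apply/esym/cvg_lim => //; exact: hf.
  - by move=> n; exact/measurable_EFinP.
  - by move=> n y _; rewrite lee_fin.
  - by move=> y _ m n mn; rewrite lee_fin; exact/lefP/nd_nnsfun_approx.
have mh n : measurable_fun setT (fun x => (h n (phi x))%:E).
  by apply/measurable_EFinP/measurableT_comp.
have -> : \int[mu]_x (f (phi x) * (w x)%:E) =
    limn (fun n => \int[mu]_x ((h n (phi x))%:E * (w x)%:E)).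
  rewrite -monotone_convergence//.
  - apply: eq_integral => x _; apply/esym/cvg_lim => //.
    by apply: cvgeZr => //; exact: hf.
  - by move=> n; exact: emeasurable_funM.
  - by move=> n x _; rewrite mule_ge0// lee_fin.
  - move=> x _ m n mn; apply: lee_wpmul2r; rewrite lee_fin//.
    exact/lefP/nd_nnsfun_approx.
congr (limn _); apply/funext => n.
under eq_integral do rewrite fimfunE -fsumEFin//.
rewrite ge0_integral_fsum//; last 2 first.
- by move=> y; exact/measurable_EFinP/measurable_funM.
- by move=> y x _; rewrite nnfun_muleindic_ge0.
transitivity (\int[mu]_x (\sum_(y \in range (h n))
    (y * \1_(h n @^-1` [set y]) (phi x))%:E * (w x)%:E)); last first.
  apply: eq_integral => x _; rewrite -ge0_mule_fsuml => [|y]; last first.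
    exact: nnfun_muleindic_ge0.
  by rewrite fsumEFin // -fimfunE.
have mi r : measurable_fun setT (fun x => (\1_(h n @^-1` [set r]) (phi x))%:E : \bar R).
  apply/measurable_EFinP; apply: (measurableT_comp _ mphi).
  exact: measurable_indic.
rewrite ge0_integral_fsum//; last 2 first.
- move=> r; apply: emeasurable_funM => //.
  under eq_fun do rewrite EFinM; exact: measurable_funeM.
- move=> r x _; apply: mule_ge0; last by rewrite lee_fin.
  exact: nnfun_muleindic_ge0.
apply: eq_fsbigr => r rhn.
have r0 : (0 <= r)%R by move: rhn; rewrite inE => -[t _ <-].
under [RHS]eq_integral do rewrite EFinM -muleA.
rewrite ge0_integralZl//; last 2 first.
- exact: emeasurable_funM.
- by move=> x _; rewrite mule_ge0// lee_fin.
under eq_integral do rewrite EFinM.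
rewrite ge0_integralZl//; last by apply/measurable_EFinP; exact: measurable_indic.
congr (_ * _).
transitivity (\int[mu]_(x in phi @^-1` (h n @^-1` [set r])) (w x)%:E).
  by rewrite integral_indic// setIT.
rewrite integral_mkcond.
apply: eq_integral => x _; rewrite patchE indicE /=.
rewrite (_ : (x \in _) = (phi x \in h n @^-1` [set r]))//.
by case: ifP => _; rewrite ?mul1e ?mul0e.
Qed.

End weighted_pushforward.

(** * One-variable substitutions in the Lebesgue integral *)

Section substitution.
Context {R : realType}.
Local Notation mu := (@lebesgue_measure R).

(** The measure [w dx] pushed forward by [phi] agrees with Lebesgue measure on half-open intervals,
    hence everywhere by uniqueness. Only the mass of preimages of intervals has to be computed, so
    [phi] may behave badly where [w] vanishes. *)
Lemma lebesgue_substitution (phi w : R -> R) (f : R -> \bar R) :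
  measurable_fun setT phi -> measurable_fun setT w -> (forall x, 0 <= w x) ->
  (forall a b, a < b ->
    (\int[mu]_(x in phi @^-1` `]a, b]) (w x)%:E = (b - a)%:E)%E) ->
  measurable_fun setT f -> (forall y, (0 <= f y)%E) ->
  (\int[mu]_y f y = \int[mu]_x (f (phi x) * (w x)%:E))%E.
Proof.
move=> mphi mw w0 H mf f0.
(* [measurableTypeR R] is the measurable type that carries [mu]; the hypotheses are restated on it
   so that the push-forward has the type of [mu]. *)
have mphi' : @measurable_fun _ _ (measurableTypeR R) (measurableTypeR R) setT phi by exact: mphi.
have mw' : @measurable_fun _ _ (measurableTypeR R) R setT w by exact: mw.
have mf' : @measurable_fun _ _ (measurableTypeR R) (\bar R) setT f by exact: mf.
move=> {mphi mw mf}.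
have <- := ge0_integral_wpush mu mphi' mw' w0 mf' f0.
apply: eq_measure_integral => A mA _.
apply: (lebesgue_measure_unique (mu := wpush_measure mu mphi' mw' w0)) => //.
move=> X /= [[a b] _] /= <-; rewrite lebesgue_measure_itv/= lte_fin.
rewrite [RHS](_ : _ = (\int[mu]_(x in phi @^-1` `]a, b]) (w x)%:E)%E)//.
case: ltP => [ab|ba]; first by rewrite H.
rewrite set_itv_ge; last by rewrite bnd_simp -leNgt.
by rewrite preimage_set0 integral_set0.
Qed.

Lemma ge0_integral_affine (f : R -> \bar R) (s c : R) : 0 < s ->
  measurable_fun setT f -> (forall y, (0 <= f y)%E) ->
  (\int[mu]_y f y = \int[mu]_x (f (s * x + c)%R * s%:E))%E.
Proof.
move=> s0 mf f0; apply: (lebesgue_substitution (w := fun=> s)) => //.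
- by apply: measurable_funD => //; exact: measurable_funM.
- by move=> _; exact: ltW.
move=> a b ab.
rewrite (_ : _ @^-1` _ = `](a - c) / s, (b - c) / s]%classic); last first.
  apply/seteqP; split => x /=; rewrite !in_itv/= ltr_pdivrMr// ler_pdivlMr//.
    by rewrite mulrC ltrBlDr lerBrDr.
  by rewrite mulrC ltrBlDr lerBrDr.
rewrite integral_cst//= lebesgue_measure_itv/= lte_fin ltr_pM2r ?invr_gt0//.
by rewrite ltrD2r ab -EFinB -EFinM; congr EFin; field; rewrite gt_eqF.
Qed.

Lemma ge0_integral_opp (f : R -> \bar R) :
  measurable_fun setT f -> (forall y, (0 <= f y)%E) ->
  (\int[mu]_y f y = \int[mu]_x f (- x)%R)%E.
Proof.
move=> mf f0; rewrite [LHS](lebesgue_substitution (phi := -%R) (w := fun=> 1))//.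
  by apply: eq_integral => x _; rewrite mule1.
move=> a b ab; rewrite opp_preimage_itvbndbnd/= integral_cst//=.
by rewrite lebesgue_measure_itv/= lte_fin ltrN2 ab mul1e opprK addrC.
Qed.

Lemma is_derive_Ncot (t : R) : sin t != 0 ->
  is_derive t 1 (fun x => - (cos x / sin x)) (sin t ^- 2).
Proof.
move=> s0.
have -> : (fun x => - (cos x / sin x)) = - (cos * (fun x => (sin x)^-1)) by [].
have dV := is_deriveV (f := sin) s0 (is_derive_sin t).
apply: is_derive_eq.
rewrite /GRing.scale/=.
have := cos2Dsin2 t => E.
apply: (mulIf (expf_neq0 2 s0)); rewrite mulVf ?expf_neq0//.
transitivity (cos t ^+2 + sin t ^+ 2); last exact: E.
by field.
Qed.

Lemma measurable_sin : measurable_fun setT (@sin R).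
Proof. by apply: continuous_measurable_fun; exact: continuous_sin. Qed.

Lemma measurable_cos : measurable_fun setT (@cos R).
Proof. by apply: continuous_measurable_fun; exact: continuous_cos. Qed.

Lemma measurable_invr : measurable_fun setT (@GRing.inv R).
Proof.
rewrite (_ : setT = [set 0%R] `|` ~` [set 0%R]); last by rewrite setUv.
apply/measurable_funU => //; first exact: measurableC.
split; first exact: measurable_fun_set1.
apply: open_continuous_measurable_fun; first exact: closed_openC.
move=> x; rewrite inE/= => /eqP x0; exact: inv_continuous.
Qed.


(** The substitution [y = - cot x], an increasing bijection from []0, pi[] onto the line with
    derivative [1 / sin^2]. It parametrizes a horizontal line by the polar angle. *)
Lemma ge0_integral_Ncot (f : R -> \bar R) :
  measurable_fun setT f -> (forall y, (0 <= f y)%E) ->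
  (\int[mu]_y f y =
   \int[mu]_(x in `]0%R, pi[) (f (- (cos x / sin x))%R * (sin x ^- 2)%:E))%E.
Proof.
move=> mf f0.
pose T x : R := - (cos x / sin x).
(* Cutting the weight to []0, pi[] silences the other branches of the cotangent. *)
pose w := (fun x : R => sin x ^- 2) \_ `]0%R, pi[%classic.
have mVs : measurable_fun setT (fun x : R => (sin x)^-1).
  exact: (measurableT_comp measurable_invr measurable_sin).
have mT : measurable_fun setT T.
  by apply: measurable_funN; apply: measurable_funM => //; exact: measurable_cos.
have mw : measurable_fun setT w.
  apply/(measurable_restrictT _ _).1 => //.
  apply: measurable_funTS; under eq_fun do rewrite -exprVn.
  exact: measurable_funX.
have w0 x : 0 <= w x.
  by rewrite /w patchE; case: ifP => // _; rewrite invr_ge0 sqr_ge0.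
rewrite [LHS](lebesgue_substitution (phi := T) (w := w))//.
  rewrite [RHS]integral_mkcond; apply: eq_integral => x _.
  by rewrite /w !patchE; case: ifP => // _; rewrite mule0.
move=> a b ab.
have p2 : pi / 2 < pi :> R by have := pi_gt0 R; lra.
(* [al] inverts [T] on []0, pi[], since [- cot (s + pi / 2) = tan s]. *)
pose al c : R := atan c + pi / 2.
have al0 c : 0 < al c < pi.
  have := atan_gtNpi2 c; have := atan_ltpi2 c; rewrite /al; lra.
have Tal c : T (al c) = c.
  rewrite /T /al cosDpihalf sinDpihalf mulNr opprK; exact: atanK.
have sgt x : 0 < x < pi -> 0 < sin x by move=> ?; exact: sin_gt0_pi.
have inc x y : 0 < x -> x < y -> y < pi -> T x < T y.
  move=> x0 xy yp.
  have dT t : t \in `]x, y[ -> is_derive t 1 T (sin t ^- 2).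
    rewrite in_itv/= => /andP[? ?]; apply: is_derive_Ncot.
    by rewrite gt_eqF// sgt//; apply/andP; split; lra.
  have [|c cxy E] := MVT xy dT.
    apply: derivable_within_continuous => t; rewrite in_itv/= => /andP[? ?].
    have /is_derive_Ncot [] : sin t != 0; last by [].
    by rewrite gt_eqF// sgt//; apply/andP; split; lra.
  rewrite -subr_gt0 E mulr_gt0 ?subr_gt0// invr_gt0 exprn_gt0// sgt//.
  by move: cxy; rewrite in_itv/= => /andP[? ?]; apply/andP; split; lra.
have alab : al a < al b by rewrite /al ltrD2r; exact: lt_atan.
rewrite /w integral_mkcond.
(* Inside []0, pi[] monotonicity of [T] identifies the preimage of []a, b]] with []al a, al b]]. The
   fundamental theorem of calculus with primitive [T] then gives [T (al b) - T (al a) = b - a]. *)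
transitivity (\int[mu]_(x in `]al a, al b]) (sin x ^- 2)%:E)%E.
  rewrite [RHS]integral_mkcond; apply: eq_integral => x _.
  rewrite !patchE.
  have -> : (x \in T @^-1` `]a, b]%classic) = (a < T x <= b).
    by apply/idP/idP; rewrite inE/= in_itv/=.
  rewrite !mem_setE !in_itv/=.
  have [/andP[a1 a2] /andP[b1 b2]] := (al0 a, al0 b).
  case: (boolP (al a < x <= al b)).
    move=> /andP[ax xb].
    have -> : a < T x <= b.
      rewrite -{1}(Tal a) -[leRHS](Tal b); apply/andP; split.
        by apply: inc => //; lra.
      move: xb; rewrite le_eqVlt => /predU1P[->//|xb]; apply/ltW/inc => //; lra.
    have -> // : 0 < x < pi by apply/andP; split; lra.
  move=> xN; case: ifPn => // /andP[ax xb].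
  case: ifPn => // /andP[x0 xp]; exfalso.
  move: xN; rewrite negb_and -leNgt -ltNge => /orP[xa|bx].
    move: xa; rewrite le_eqVlt => /predU1P[xa|xa].
      by move: ax; rewrite xa Tal ltxx.
    have := inc _ _ x0 xa a2; rewrite Tal => h.
    by move: (lt_trans ax h); rewrite ltxx.
  have := inc _ _ b1 bx xp; rewrite Tal => h.
  by move: (lt_le_trans h xb); rewrite ltxx.
have [/andP[a1 a2] /andP[b1 b2]] := (al0 a, al0 b).
have sn x : x \in `[al a, al b] -> sin x != 0.
  by rewrite in_itv/= => /andP[? ?]; rewrite gt_eqF// sgt//; apply/andP; split; lra.
have cV : {within `[al a, al b], continuous (fun x : R => sin x ^- 2)}.
  apply: continuous_in_subspaceT => x; rewrite inE/= => /sn sx.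
  apply: cvgV; first by rewrite expf_neq0.
  apply: (@continuous_comp _ _ _ (@sin R) (fun y : R => y ^+ 2)).
    exact: continuous_sin.
  exact: exprn_continuous.
rewrite integral_itv_obnd_cbnd; last first.
  apply: measurable_funTS; apply/measurable_EFinP.
  under eq_fun do rewrite -exprVn; exact: measurable_funX.
rewrite (continuous_FTC2 (F := T))// ?Tal//.
- have dT t : t \in `[al a, al b] -> derivable T t 1.
    by move=> /sn /is_derive_Ncot [].
  have cT t : t \in `[al a, al b] -> {for t, continuous T}.
    by move=> /dT /derivable1_diffP /differentiable_continuous.
  split.
  + by move=> x xab; apply: dT; exact: subset_itv_oo_cc.
  + by apply: cvg_at_right_filter; apply: cT; rewrite in_itv/= lexx ltW.
  + by apply: cvg_at_left_filter; apply: cT; rewrite in_itv/= lexx ltW.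
- move=> x xab; have /sn sx : x \in `[al a, al b] by exact: subset_itv_oo_cc.
  by have dT := is_derive_Ncot sx; rewrite derive1E derive_val.
Qed.

End substitution.

(** * Tonelli on rectangles *)

Section tonelli_in.
Local Open Scope ereal_scope.
Context d1 d2 (T1 : measurableType d1) (T2 : measurableType d2) (R : realType).
Variables (m1 : {sigma_finite_measure set T1 -> \bar R}).
Variables (m2 : {sigma_finite_measure set T2 -> \bar R}).
Variables (A : set T1) (B : set T2) (f : T1 * T2 -> \bar R).
Hypotheses (mA : measurable A) (mB : measurable B).
Hypothesis mf : measurable_fun setT f.
Hypothesis f0 : forall x y, A x -> B y -> 0 <= f (x, y).

(** Extension by zero makes the integrand nonnegative everywhere: [f] itself may be negative off the
    rectangle, as happens with the factor [sin] of the surface element. *)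
Let g := f \_ (A `*` B).

Let mg : measurable_fun setT g.
Proof.
apply/(measurable_restrictT _ _).1; first exact: measurableX.
exact: measurable_funTS.
Qed.

Let g0 z : 0 <= g z.
Proof.
by case: z => x y; rewrite /g patchE; case: ifPn => //; rewrite inE => -[? ?]; exact: f0.
Qed.

Let gE x y : g (x, y) = ((fun x => ((fun y => f (x, y)) \_ B) y) \_ A) x.
Proof.
rewrite /g !patchE; case: ifPn.
  by rewrite inE/= => -[xA yB]; rewrite !mem_set.
rewrite notin_setE => /= h; case: ifPn => //; rewrite inE => xA.
by case: ifPn => //; rewrite inE => yB; exfalso; apply: h.
Qed.

Let gint1 x : \int[m2]_y g (x, y) = ((fun x => \int[m2]_(y in B) f (x, y)) \_ A) x.
Proof.
rewrite patchE; case: ifPn => xA.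
  rewrite [RHS]integral_mkcond; apply: eq_integral => y _.
  by rewrite gE patchE xA.
by rewrite integral0_eq// => y _; rewrite gE patchE (negbTE xA).
Qed.

Let gint2 y : \int[m1]_x g (x, y) = ((fun y => \int[m1]_(x in A) f (x, y)) \_ B) y.
Proof.
rewrite patchE; case: ifPn => yB.
  rewrite [RHS]integral_mkcond; apply: eq_integral => x _.
  by rewrite gE !patchE yB; case: ifP.
by rewrite integral0_eq// => x _; rewrite gE !patchE (negbTE yB); case: ifP.
Qed.

Lemma tonelli_in1 : \int[m1 \x m2]_(z in A `*` B) f z =
  \int[m1]_(x in A) \int[m2]_(y in B) f (x, y).
Proof.
rewrite integral_mkcond [RHS]integral_mkcond (fubini_tonelli1 _ mg g0).
by apply: eq_integral => x _; rewrite -gint1.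
Qed.

Lemma tonelli_in2 : \int[m1 \x m2]_(z in A `*` B) f z =
  \int[m2]_(y in B) \int[m1]_(x in A) f (x, y).
Proof.
rewrite integral_mkcond [RHS]integral_mkcond (fubini_tonelli2 _ mg g0).
by apply: eq_integral => x _; rewrite -gint2.
Qed.

Lemma tonelli_in : \int[m1]_(x in A) \int[m2]_(y in B) f (x, y) =
  \int[m2]_(y in B) \int[m1]_(x in A) f (x, y).
Proof. by rewrite -tonelli_in1 tonelli_in2. Qed.

Lemma measurable_integral_in1 :
  measurable_fun A (fun x => \int[m2]_(y in B) f (x, y)).
Proof.
apply/(measurable_restrictT _ _).2 => //.
rewrite [X in measurable_fun _ X](_ : _ = fubini_F m2 g).
  exact: measurable_fun_fubini_tonelli_F.
by apply/funext => x; rewrite /fubini_F gint1.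
Qed.

End tonelli_in.

(** * Polar and spherical coordinates *)

Section polar.
Context {R : realType}.
Local Notation T := (measurableTypeR R).
Local Notation mu := (@lebesgue_measure R).

Let mfst := @measurable_fst _ _ T T.
Let msnd := @measurable_snd _ _ T T.

(** On the line at height [y > 0] put [x = y cot t], so that [dx] becomes [y / sin^2 t dt]. After
    exchanging the integrals put [y = r sin t] at fixed [t]: then [y / sin^2 t dy = r dr] and
    [y cot t = r cos t]. *)
Lemma half_plane_polar (k : T * T -> \bar R) :
  measurable_fun setT k -> (forall z, (0 <= k z)%E) ->
  (\int[mu]_(y in `]0%R, +oo[) \int[mu]_x k (x, y) =
   \int[mu]_(r in `]0%R, +oo[) \int[mu]_(t in `]0%R, pi[)
     (k (r * cos t, r * sin t)%R * r%:E))%E.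
Proof.
move=> mk k0.
have mc : measurable_fun setT (fun z : T * T => cos z.2).
  exact: (measurableT_comp measurable_cos msnd).
have ms : measurable_fun setT (fun z : T * T => sin z.2).
  exact: (measurableT_comp measurable_sin msnd).
have mVs : measurable_fun setT (fun z : T * T => (sin z.2)^-1).
  exact: (measurableT_comp measurable_invr ms).
have mVs2 : measurable_fun setT (fun z : T * T => sin z.2 ^- 2).
  by under eq_fun do rewrite -exprVn; exact: measurable_funX.
pose G (z : T * T) := (k (z.1 * (cos z.2 / sin z.2), z.1)%R * (z.1 * sin z.2 ^- 2)%:E)%E.
have mG : measurable_fun setT G.
  apply: emeasurable_funM; last by apply/measurable_EFinP; exact: measurable_funM.
  apply: (measurableT_comp mk); apply: measurable_fun_pair => //.
  by apply: measurable_funM => //; exact: measurable_funM.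
have ky y : measurable_fun setT (fun x => k (x, y)).
  exact: measurable_fun_pair1 mk.
transitivity (\int[mu]_(y in `]0%R, +oo[) \int[mu]_(t in `]0%R, pi[) G (y, t))%E.
  apply: eq_integral => y; rewrite inE/= in_itv/= andbT => y0.
  (* The reflection compensates for the sign in [- cot], and the dilation by [y] that follows
     produces [x = y cot t]. *)
  rewrite ge0_integral_opp//; last exact: ky.
  rewrite (@ge0_integral_affine _ _ y 0)//; last first.
    by apply: (measurableT_comp (ky y)); exact: measurable_funN.
  rewrite ge0_integral_Ncot//; last 2 first.
  - apply: emeasurable_funM => //.
    apply: (measurableT_comp (ky y)); apply: measurable_funN.
    by apply: measurable_funD => //; exact: measurable_funM.
  - by move=> x; rewrite mule_ge0// lee_fin ltW.
  apply: eq_integral => t _; rewrite /G/= -muleA EFinM; congr (k (_, _) * _)%E.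
  by rewrite addr0 mulrN opprK.
have mI (i : interval R) : measurable ([set` i] : set T) by exact: measurable_itv.
rewrite (@tonelli_in _ _ T T R mu mu _ _ G (mI _) (mI _) mG); last first.
  move=> x y /=; rewrite in_itv/= andbT => x0 _.
  by rewrite /G/= mule_ge0// lee_fin mulr_ge0 ?(ltW x0)// invr_ge0 sqr_ge0.
transitivity (\int[mu]_(t in `]0%R, pi[) \int[mu]_(r in `]0%R, +oo[)
     (k (r * cos t, r * sin t)%R * r%:E))%E; last first.
  rewrite (@tonelli_in _ _ T T R mu mu _ _ (fun z => k (z.2 * cos z.1, z.2 * sin z.1)%R * z.2%:E)%E (mI _) (mI _)) //.
    apply: emeasurable_funM; last exact/measurable_EFinP.
    apply: (measurableT_comp mk); apply: measurable_fun_pair.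
      by apply: measurable_funM => //; exact: (measurableT_comp measurable_cos mfst).
    by apply: measurable_funM => //; exact: (measurableT_comp measurable_sin mfst).
  move=> x y /= _; rewrite in_itv/= andbT => y0.
  by rewrite mule_ge0// lee_fin ltW.
apply: eq_integral => t; rewrite inE/= in_itv/= => t0.
have st : 0 < sin t by exact: sin_gt0_pi.
rewrite [LHS]integral_mkcond [RHS]integral_mkcond.
rewrite (@ge0_integral_affine _ _ (sin t) 0)//; last 2 first.
- apply/(measurable_restrictT _ _).1 => //; apply: measurable_funTS.
  exact: measurable_fun_pair1 mG.
- move=> y; rewrite patchE; case: ifPn => //; rewrite inE/= in_itv/= andbT => y0.
  by rewrite /G/= mule_ge0// lee_fin mulr_ge0 ?(ltW y0)// invr_ge0 sqr_ge0.
apply: eq_integral => r _; rewrite !patchE.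
have -> : (sin t * r + 0 \in `]0%R, +oo[%classic) = (r \in `]0%R, +oo[%classic).
  by rewrite !mem_setE !in_itv/= !andbT addr0 pmulr_rgt0.
case: ifPn => _; last by rewrite mul0e.
rewrite /G/= addr0 -muleA -EFinM; congr (k (_, _) * _%:E)%E.
- by field; rewrite gt_eqF.
- by rewrite mulrC.
- by field; rewrite gt_eqF.
Qed.

End polar.

Section spherical.
Context {R : realType}.
Local Notation T := (measurableTypeR R).
Local Notation mu := (@lebesgue_measure R).

Let mI (i : interval R) : measurable ([set` i] : set T).
Proof. exact: measurable_itv. Qed.

Lemma ge0_integral_circle (q : T -> \bar R) :
  measurable_fun setT q -> (forall t, (0 <= q t)%E) ->
  (\int[mu]_(t in `[0%R, (2 * pi)%R]) q t =
   \int[mu]_(t in `]0%R, pi[) q t + \int[mu]_(t in `]0%R, pi[) q (t + pi)%R)%E.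
Proof.
move=> mq q0.
have p0 := pi_gt0 R.
have -> : `[0%R, (2 * pi)%R]%classic = `[0%R, pi]%classic `|` `]pi, (2 * pi)%R]%classic :> set T.
  by rewrite -itv_bndbnd_setU// bnd_simp; lra.
rewrite ge0_integral_setU//; last 2 first.
- exact: measurable_funTS.
- apply/disj_setPS => x [] /=; rewrite !in_itv/= => /andP[_ h] /andP[h' _].
  by move: (lt_le_trans h' h); rewrite ltxx.
rewrite (@integral_itv_bndoo _ 0 pi)//; last exact: measurable_funTS.
rewrite (@integral_itv_bndoo _ pi (2 * pi))//; last exact: measurable_funTS.
congr (_ + _)%E.
rewrite [LHS]integral_mkcond [RHS]integral_mkcond.
rewrite (@ge0_integral_affine _ _ 1 pi)//; last 2 first.
- by apply/(measurable_restrictT _ _).1 => //; exact: measurable_funTS.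
- by move=> y; rewrite patchE; case: ifPn.
apply: eq_integral => t _; rewrite mule1 mul1r !patchE.
suff -> : (t + pi \in `]pi, (2 * pi)%R[%classic) = (t \in `]0%R, pi[%classic) by [].
rewrite !mem_setE !in_itv/=.
by apply/idP/idP => /andP[? ?]; apply/andP; split; lra.
Qed.

(** The lower half plane is the image of the upper one under [z -> - z], which in polar coordinates
    is the shift [t -> t + pi]. *)
Lemma plane_polar (k : T * T -> \bar R) :
  measurable_fun setT k -> (forall z, (0 <= k z)%E) ->
  (\int[mu]_y \int[mu]_x k (x, y) =
   \int[mu]_(r in `]0%R, +oo[) \int[mu]_(t in `[0%R, (2 * pi)%R])
     (k (r * cos t, r * sin t)%R * r%:E))%E.
Proof.
move=> mk k0.
pose g (y : T) := (\int[mu]_x k (x, y))%E.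
have mg : measurable_fun setT g.
  exact: (@measurable_fun_fubini_tonelli_G _ _ T T R mu k mk k0).
have g0 y : (0 <= g y)%E by exact: integral_ge0.
rewrite -[LHS]/(\int[mu]_y g y)%E.
have -> : [set: T] = `]-oo, 0%R]%classic `|` `]0%R, +oo[%classic.
  by rewrite -itv_bndbnd_setU// set_itvE.
rewrite ge0_integral_setU//; last 2 first.
- by rewrite -itv_bndbnd_setU// set_itvE.
- apply/disj_setPS => x [] /=; rewrite !in_itv/= andbT => h h'.
  by move: (lt_le_trans h' h); rewrite ltxx.
pose k' (z : T * T) := k (- z.1, - z.2).
have mk' : measurable_fun setT k'.
  apply: (measurableT_comp mk); apply: measurable_fun_pair.
    by apply: measurable_funN; exact: measurable_fst.
  by apply: measurable_funN; exact: measurable_snd.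
have -> : (\int[mu]_(y in `]-oo, 0%R]) g y =
    \int[mu]_(y in `]0%R, +oo[) \int[mu]_x k' (x, y))%E.
  transitivity (\int[mu]_(y in `]-oo, 0%R]) g (- - y)%R)%E.
    by apply: eq_integral => y _; rewrite opprK.
  have mgN : measurable_fun setT (fun y : R => g (- y)).
    by apply: (measurableT_comp mg); exact: measurable_funN.
  rewrite -(ge0_integration_by_substitution0 (f := fun y => g (- y)%R))//.
  rewrite -integral_itv_obnd_cbnd; last exact: measurable_funTS.
  apply: eq_integral => y _; rewrite /g /k' /=.
  rewrite ge0_integral_opp//; exact: (measurable_fun_pair1 (- y : T) mk).
have k'0 z : (0 <= k' z)%E by exact: k0.
rewrite (half_plane_polar mk' k'0).
have -> : (\int[mu]_(y in `]0%R, +oo[) g y = _)%E := half_plane_polar mk k0.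
(* One formula for both half planes, with [s = 1] or [s = -1]. The absolute value agrees with the
   Jacobian for [r > 0] and keeps [Q] nonnegative for all radii. *)
pose Q (s : R) (z : T * T) := (k (s * (z.1 * cos z.2), s * (z.1 * sin z.2))%R * `|z.1|%:E)%E.
have mQ s : measurable_fun setT (Q s).
  apply: emeasurable_funM; last first.
    by apply/measurable_EFinP; apply: measurableT_comp => //; exact: measurable_fst.
  apply: (measurableT_comp mk); apply: measurable_fun_pair;
      apply: measurable_funM => //; apply: measurable_funM;
      try exact: measurable_fst.
    exact: (measurableT_comp measurable_cos measurable_snd).
  exact: (measurableT_comp measurable_sin measurable_snd).
have Q0 s z : (0 <= Q s z)%E by rewrite mule_ge0// lee_fin.
rewrite addeC.
have -> : (\int[mu]_(r in `]0%R, +oo[) \int[mu]_(t in `]0%R, pi[)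
     (k (r * cos t, r * sin t)%R * r%:E) =
   \int[mu]_(r in `]0%R, +oo[) \int[mu]_(t in `]0%R, pi[) Q 1%R (r, t))%E.
  apply: eq_integral => r; rewrite inE/= in_itv/= andbT => r0.
  by apply: eq_integral => t _; rewrite /Q/= !mul1r gtr0_norm.
have -> : (\int[mu]_(r in `]0%R, +oo[) \int[mu]_(t in `]0%R, pi[)
     (k' (r * cos t, r * sin t)%R * r%:E) =
   \int[mu]_(r in `]0%R, +oo[) \int[mu]_(t in `]0%R, pi[) Q (-1)%R (r, t))%E.
  apply: eq_integral => r; rewrite inE/= in_itv/= andbT => r0.
  by apply: eq_integral => t _; rewrite /Q/= !mulN1r gtr0_norm.
have mQint s : measurable_fun (`]0%R, +oo[%classic : set T) (fun r => \int[mu]_(t in `]0%R, pi[) Q s (r, t))%E.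
  exact: (@measurable_integral_in1 _ _ T T R mu _ _ (Q s) (mI _) (mI _) (mQ s)).
rewrite -ge0_integralD//; last 2 first.
- by move=> r _; exact: integral_ge0.
- by move=> r _; exact: integral_ge0.
apply: eq_integral => r; rewrite inE/= in_itv/= andbT => r0.
transitivity (\int[mu]_(t in `[0%R, (2 * pi)%R]) Q 1%R (r, t))%E; last first.
  by apply: eq_integral => t _; rewrite /Q/= !mul1r gtr0_norm.
rewrite ge0_integral_circle//; last exact: (measurable_fun_pair2 (r : T) (mQ 1)).
congr (_ + _)%E; apply: eq_integral => t _.
by rewrite /Q/= cosDpi sinDpi !mulN1r !mul1r !mulrN.
Qed.

(* The canonical sigma-finite structure on product measures is shadowed by the
   one on products of subprobabilities, hence the explicit [leb2]. *)
Lemma sigma_finite_leb2 : sigma_finite setT (mu \x mu)%E.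
Proof.
pose I n : set T := `[- n%:R, n%:R]%classic.
exists (fun n => I n `*` I n).
  apply/seteqP; split => // -[x y] _.
  pose b := Num.bound (Num.max `|x| `|y|).
  have hb : Num.max `|x| `|y| < b%:R by rewrite archi_boundP// le_max normr_ge0.
  move: hb; rewrite gt_max => /andP[hx hy].
  move: hx hy; rewrite !ltr_norml => /andP[? ?] /andP[? ?].
  by exists b => //; split; apply/andP; rewrite !bnd_simp; split; exact: ltW.
move=> n; have mIn : measurable (I n) by exact: measurable_itv.
split; first exact: measurableX.
have mun : mu (I n) \is a fin_num.
  by have -> := lebesgue_measure_itv `[- n%:R, n%:R]; case: ifP.
by rewrite product_measure1E// -ge0_fin_numE ?mule_ge0// fin_numM.
Qed.
Definition leb2 : {sigma_finite_measure set (T * T)%type -> \bar R} :=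
  HB.pack_for {sigma_finite_measure set (T * T)%type -> \bar R} (mu \x mu)%E
    (Measure_isSigmaFinite.Build _ _ _ (mu \x mu)%E sigma_finite_leb2).

(** Polar coordinates are used twice. Horizontal planes give cylindrical coordinates, with
    [K (z, rho)] the integral over the circle of radius [rho] at height [z]; then [z = r cos t],
    [rho = r sin t] in the half plane [rho > 0]. The Jacobians multiply to [rho r = r^2 sin t]. *)
Lemma spherical_coordinates (f : P3 R -> R) :
  measurable_fun (setT : set (T * T * T)) f -> (forall x, 0 <= f x) ->
  (\int[@leb3 R]_x (f x)%:E =
   \int[mu]_(r in `]0%R, +oo[) sphere_integral r f)%E.
Proof.
move=> mf f0.
have mfE : measurable_fun (setT : set (T * T * T)) (fun x => (f x)%:E).
  exact/measurable_EFinP.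
have fE0 (x : T * T * T) : (0 <= (f x)%:E)%E by rewrite lee_fin.
have mz (z : T) : measurable_fun (setT : set (T * T)) (fun xy => (f (xy, z))%:E).
  exact: (measurable_fun_pair1 z mfE).
rewrite [LHS](@fubini_tonelli2 _ _ (T * T)%type T R leb2 mu _ mfE fE0) /fubini_G.
pose K (w : T * T) := (\int[mu]_(t in `[0%R, (2 * pi)%R])
  ((f (w.2 * cos t, w.2 * sin t, w.1))%:E * `|w.2|%:E))%E.
have mK : measurable_fun setT K.
  have mfst2 := @measurable_fst _ _ (T * T)%type T.
  have msnd2 := @measurable_snd _ _ (T * T)%type T.
  apply: (@measurable_integral_in1 _ _ (T * T)%type T R mu setT _ (fun w =>
    ((f (w.1.2 * cos w.2, w.1.2 * sin w.2, w.1.1))%:E * `|w.1.2|%:E)%E) measurableT (mI _)).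
    have m12 : measurable_fun setT (fun w : T * T * T => w.1.2).
      exact: (measurableT_comp measurable_snd mfst2).
    apply: emeasurable_funM; last by apply/measurable_EFinP; exact: measurableT_comp.
    apply: (measurableT_comp mfE); apply: measurable_fun_pair; last first.
      exact: (measurableT_comp measurable_fst mfst2).
    apply: measurable_fun_pair; apply: measurable_funM => //.
      exact: (measurableT_comp measurable_cos msnd2).
    exact: (measurableT_comp measurable_sin msnd2).
  by move=> x y _ _ /=; rewrite -EFinM lee_fin mulr_ge0.
have K0 w : (0 <= K w)%E.
  by apply: integral_ge0 => t _; rewrite -EFinM lee_fin mulr_ge0.
transitivity (\int[mu]_z \int[mu]_(r in `]0%R, +oo[) K (z, r))%E.
  apply: eq_integral => z _.
  have fz0 (xy : T * T) : (0 <= (f (xy, z))%:E)%E by rewrite lee_fin.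
  rewrite (@fubini_tonelli2 _ _ T T R mu mu _ (mz z) fz0) /fubini_G (plane_polar (mz z) fz0).
  apply: eq_integral => r; rewrite inE/= in_itv/= andbT => r0.
  by apply: eq_integral => t _; rewrite gtr0_norm.
rewrite (@tonelli_in _ _ T T R mu mu setT _ K measurableT (mI _) mK); last by move=> *; exact: K0.
rewrite half_plane_polar//.
apply: eq_integral => r; rewrite inE/= in_itv/= andbT => r0.
rewrite /sphere_integral.
have mS : measurable_fun (setT : set (T * T))
    (fun z => (f (sph r z) * r ^+ 2 * sin z.1)%:E).
  have ms1 : measurable_fun (setT : set (T * T)) (fun z => sin z.1).
    exact: (measurableT_comp measurable_sin measurable_fst).
  apply/measurable_EFinP; apply: measurable_funM => //; apply: measurable_funM => //.
  apply: (measurableT_comp mf); apply: measurable_fun_pair; last first.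
    by apply: measurable_funM => //; exact: (measurableT_comp measurable_cos measurable_fst).
  apply: measurable_fun_pair; apply: measurable_funM;
    try (by apply: measurable_funM).
    exact: (measurableT_comp measurable_cos measurable_snd).
  exact: (measurableT_comp measurable_sin measurable_snd).
have S0 (x y : T) : `[0%R, pi]%classic x -> `[0%R, (2 * pi)%R]%classic y ->
    (0 <= (f (sph r (x, y)) * r ^+ 2 * sin (x, y).1)%:E)%E.
  rewrite /= in_itv/= => xp _.
  by rewrite lee_fin/= mulr_ge0 ?sin_ge0_pi// mulr_ge0 ?sqr_ge0.
rewrite (@tonelli_in1 _ _ T T R mu mu _ _ _ (mI _) (mI _) mS S0).
rewrite [RHS](@integral_itv_bndoo _ 0 pi)//; last first.
  apply: (measurable_funS (mI `[0%R, pi])).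
    exact: subset_itv_oo_cc.
  exact: (@measurable_integral_in1 _ _ T T R mu `[0%R, pi]%classic `[0%R, (2 * pi)%R]%classic
    (fun z => (f (sph r z) * r ^+ 2 * sin z.1)%:E) (mI _) (mI _) mS S0).
apply: eq_integral => t; rewrite inE/= in_itv/= => tp.
have st : 0 < sin t by exact: sin_gt0_pi.
rewrite /K/= -ge0_integralZr//.
- apply: eq_integral => p _; rewrite -!EFinM /sph/=; congr EFin.
  rewrite gtr0_norm ?mulr_gt0//; ring.
- apply: measurable_funTS; apply: emeasurable_funM => //.
  apply: (measurableT_comp mfE); apply: measurable_fun_pair => //.
  apply: measurable_fun_pair; apply: measurable_funM => //.
    exact: measurable_cos.
  exact: measurable_sin.
- by move=> p _; rewrite -EFinM lee_fin mulr_ge0.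
- by rewrite lee_fin ltW.
Qed.

End spherical.

(** * Smooth radial test fields *)

Local Notation coord := Defs.coord.

Section flat_exponential.
Context {R : realType}.
Implicit Types (k : nat) (t : R).

(** The flat function [exp (- 1 / t)] with a prefactor [t^(-k)]: with these prefactors the family is
    stable under differentiation up to linear combinations. *)
Definition expinv k t : R := if 0 < t then t ^- k * expR (- t^-1) else 0.

Lemma expinv_gt0E k t : 0 < t -> expinv k t = t ^- k * expR (- t^-1).
Proof. by rewrite /expinv => ->. Qed.

Lemma expinv_le0E k t : t <= 0 -> expinv k t = 0.
Proof. by rewrite /expinv ltNge => ->. Qed.

Lemma expinv_ge0 k t : 0 <= expinv k t.
Proof.
rewrite /expinv; case: ifP => // t0.
by rewrite mulr_ge0 ?expR_ge0// invr_ge0 exprn_ge0// ltW.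
Qed.

(** Comes from [s^(k+1) / (k+1)! <= exp s] at [s = 1 / t]; it is the flatness needed to
    differentiate at 0. *)
Lemma expinv_le k t : expinv k t <= k.+1`!%:R * `|t|.
Proof.
have [t0|t0] := ltP 0 t; last by rewrite expinv_le0E// mulr_ge0.
rewrite expinv_gt0E// gtr0_norm// expRN ler_pdivrMr ?expR_gt0//.
have t1 : 0 <= t^-1 by rewrite invr_ge0 ltW.
have := expR_ge1Dxn k t1; set e := expR _ => he.
have fp : 0 < k.+1`!%:R :> R by rewrite ltr0n fact_gt0.
have : t^-1 ^+ k.+1 / k.+1`!%:R <= e by lra.
rewrite ler_pdivrMr// => h.
rewrite -mulrA mulrCA -ler_pdivrMl// mulrC [_ * e]mulrC.
by rewrite -exprVn -exprSr.
Qed.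

Lemma expinvS k t : expinv k t / t = expinv k.+1 t.
Proof.
have [t0|t0] := ltP 0 t; last by rewrite !expinv_le0E// mul0r.
by rewrite !expinv_gt0E// exprS invfM mulrAC [t^-1 * _]mulrC.
Qed.

Lemma is_derive_expinv k t :
  is_derive t 1 (expinv k) (expinv k.+2 t - k%:R * expinv k.+1 t).
Proof.
have [t0|t0|<-] := ltgtP 0 t.
- have tn0 : t != 0 by rewrite gt_eqF.
  rewrite !expinv_gt0E//.
  have dV : is_derive t 1 (fun x : R => x^-1) (- t ^- 2 *: 1).
    exact: (is_deriveV (f := id)).
  have dE : is_derive t 1 (fun x : R => x^-1 ^+ k * expR (- x^-1))
     (t ^- k.+2 * expR (- t^-1) - k%:R * (t ^- k.+1 * expR (- t^-1))).
    have -> : (fun x : R => x^-1 ^+ k * expR (- x^-1)) =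
      ((fun x => x^-1) ^+ k) * (expR \o (- (fun x : R => x^-1))).
      by apply/funext => x; rewrite !fctE.
    apply: is_derive_eq.
    rewrite /GRing.scale/= !mulr1 !fctE /= -!exprVn.
    move: (t^-1) (expR _) => y e.
    by case: k => [|k] /=; rewrite ?exprS; ring.
  apply: near_eq_is_derive dE.
  near=> x; have x0 : 0 < x by near: x; exact: lt_nbhsr.
  by rewrite expinv_gt0E// exprVn.
- rewrite !expinv_le0E ?ltW// mulr0 subr0.
  apply: near_eq_is_derive (is_derive_cst (0 : R) t 1).
  near=> x; have x0 : x < 0 by near: x; exact: lt_nbhsl.
  by rewrite expinv_le0E// ltW.
- rewrite !expinv_le0E// mulr0 subr0.
  (* By [expinvS] the difference quotient at the junction is [expinv k.+1 h], which [expinv_le]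
     bounds by a multiple of [|h|]. *)
  have H : h^-1 *: (expinv k (h *: 1 + 0) - expinv k 0) @[h --> 0^'] --> (0 : R).
    rewrite (expinv_le0E _ (lexx 0)).
    apply/cvgrPdist_le => e e0; near=> h.
    rewrite /GRing.scale/= mulr1 addr0 subr0 sub0r normrN mulrC expinvS.
    rewrite ger0_norm ?expinv_ge0// (le_trans (expinv_le _ _))//.
    rewrite -ler_pdivlMl ?ltr0n ?fact_gt0//.
    near: h; apply: dnbhs0_le; rewrite mulr_gt0// invr_gt0 ltr0n fact_gt0//.
  split; first by apply/cvg_ex; exists 0.
  exact: (cvg_lim _ H).
Unshelve. all: by end_near.
Qed.

End flat_exponential.

(** * Function classes closed under differentiation *)

Section smooth_classes.
Context {R : realType}.

(* Smooth on ]-d, +oo[ only; profiles are evaluated at [t = |x|^2 >= 0]. *)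
Inductive profile (d : R) : (R -> R) -> Prop :=
| profile_cst c : profile d (fun=> c)
| profile_id : profile d (fun t => t)
| profile_pow a : profile d (fun t => (t + d) `^ a)
| profile_expinv k c b : profile d (fun t => expinv k (c * (b - t)))
| profile_add f g : profile d f -> profile d g -> profile d (fun t => f t + g t)
| profile_mul f g : profile d f -> profile d g -> profile d (fun t => f t * g t).

Lemma is_derive_expinv_affine k (c b t : R) :
  is_derive t 1 (fun t => expinv k (c * (b - t)))
    (- c * (expinv k.+2 (c * (b - t)) + - k%:R * expinv k.+1 (c * (b - t)))).
Proof.
have de := is_derive_expinv k (c * (b - t)).
have -> : (fun t => expinv k (c * (b - t))) = expinv k \o (c *: (cst b - id)) by [].
have ds : is_derive t 1 (c *: (cst b - id)) (- c).
  by apply: is_derive_eq; rewrite sub0r /GRing.scale/= mulrN1.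
have := @is_derive1_comp R _ (c *: (cst b - id)) t _ _ de ds.
by congr (is_derive _ _ _ _); ring.
Qed.

Lemma profile_derive d f : profile d f -> exists2 f', profile d f' &
  forall t, - d < t -> is_derive t 1 f (f' t).
Proof.
elim => {f} [c||a|k c b|f g _ [f' pf' df] _ [g' pg' dg]|f g pf [f' pf' df] pg [g' pg' dg]].
- by exists (fun=> 0); [exact: profile_cst|move=> t _; exact: is_derive_cst].
- by exists (fun=> 1); [exact: profile_cst|move=> t _; exact: is_derive_id].
- exists (fun t => a * (t + d) `^ (a - 1)) => [|t td].
    by apply: profile_mul; [exact: profile_cst|exact: profile_pow].
  have td0 : 0 < t + d by lra.
  have dp := @is_derive1_powR R a _ td0.
  have -> : (fun t => (t + d) `^ a) = (@powR R ^~ a) \o (id + cst d) by [].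
  have ds : is_derive t 1 (id + cst d) 1.
    by apply: is_derive_eq; rewrite addr0.
  by have := @is_derive1_comp R _ (id + cst d) t _ _ dp ds; rewrite mulr1.
- exists (fun t => - c * (expinv k.+2 (c * (b - t)) + (- k%:R) * expinv k.+1 (c * (b - t)))).
    apply: profile_mul; first exact: profile_cst.
    apply: profile_add; first exact: profile_expinv.
    by apply: profile_mul; [exact: profile_cst|exact: profile_expinv].
  by move=> t _; exact: is_derive_expinv_affine.
- exists (fun t => f' t + g' t); first exact: profile_add.
  by move=> t td; have := df _ td; have := dg _ td => ? ?; exact: is_deriveD.
- exists (fun t => f t * g' t + g t * f' t).
    by apply: profile_add; exact: profile_mul.
  move=> t td; have := df _ td; have := dg _ td => ? ?; exact: is_deriveM.
Qed.

Lemma profile_continuous d f t : profile d f -> - d < t -> {for t, continuous f}.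
Proof.
move=> /profile_derive[f' _ df] td; have [dft _] := df _ td.
by apply: differentiable_continuous; apply/derivable1_diffP.
Qed.

Definition sq3 (x : P3 R) : R := \sum_(i < 3) coord i x ^+ 2.

Lemma sq3_ge0 x : 0 <= sq3 x.
Proof. by apply: sumr_ge0 => i _; exact: sqr_ge0. Qed.

(** Contains the components [x_i g(|x|^2)] of the test fields. It is stable under partial
    derivatives because [f(|x|^2)] has [j]-th partial [2 x_j f'(|x|^2)], again of this form. *)
Inductive radial_poly (d : R) : (P3 R -> R) -> Prop :=
| radial_poly_coord i : radial_poly d (coord i)
| radial_poly_profile f : profile d f -> radial_poly d (fun x => f (sq3 x))
| radial_poly_add f g : radial_poly d f -> radial_poly d g ->
    radial_poly d (fun x => f x + g x)
| radial_poly_mul f g : radial_poly d f -> radial_poly d g ->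
    radial_poly d (fun x => f x * g x).

(** Restricting to the line through [x] along [v] makes the scalar chain rule available for
    compositions with [|x|^2]. *)
Lemma is_derive_lineP (F : P3 R -> R) x v l :
  is_derive x v F l <-> is_derive (0 : R) 1 (fun h : R => F (h *: v + x)) l.
Proof.
have E : 'D_v F x = 'D_1 (fun h : R => F (h *: v + x)) 0.
  rewrite /derive; congr (lim _); apply/funext => P; rewrite /fmap/=.
  congr (nbhs _ _); apply/funext => h.
  by rewrite /= addr0 scale0r add0r /GRing.scale/= mulr1.
by split => -[d0 <-]; split; rewrite ?E//; [apply/(derivable1P F x v).1|
  apply/(derivable1P F x v).2].
Qed.

Lemma coordDZ i h (v x : P3 R) : coord i (h *: v + x) = h * coord i v + coord i x.
Proof. by case: i => [[|[|[|]]]]. Qed.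

Lemma is_derive_coord i (v x : P3 R) : is_derive x v (coord i) (coord i v).
Proof.
apply/is_derive_lineP; under eq_fun do rewrite coordDZ.
have -> : (fun h => h * coord i v + coord i x) =
  (coord i v *: id + cst (coord i x) : R -> R).
  by apply/funext => h; rewrite !fctE /GRing.scale/= mulrC.
by apply: is_derive_eq; rewrite addr0 /GRing.scale/= mulr1.
Qed.

Lemma is_derive_sq3 (v x : P3 R) :
  is_derive x v sq3 (\sum_(i < 3) 2 * coord i x * coord i v).
Proof.
have H i : is_derive x v (fun y => coord i y ^+ 2) (2 * coord i x * coord i v).
  have dc := is_derive_coord i v x.
  have -> : (fun y => coord i y ^+ 2) = (coord i : P3 R -> R) ^+ 2.
    by apply/funext => y; rewrite fctE.
  by apply: is_derive_eq; rewrite /GRing.scale/= expr1.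
have -> : sq3 = \sum_(i < 3) (fun y => coord i y ^+ 2).
  by apply/funext => y; rewrite /sq3 fct_sumE.
exact: is_derive_sum.
Qed.

Lemma is_derive_radial (f : R -> R) (f' : R) (x v : P3 R) : is_derive (sq3 x) 1 f f' ->
  is_derive x v (fun y => f (sq3 y)) (f' * \sum_(i < 3) 2 * coord i x * coord i v).
Proof.
move=> df; apply/is_derive_lineP.
have ds : is_derive (0 : R) 1 (fun h : R => sq3 (h *: v + x))
    (\sum_(i < 3) 2 * coord i x * coord i v).
  exact/is_derive_lineP/is_derive_sq3.
have df0 : is_derive (sq3 (0 *: v + x)) 1 f f' by rewrite scale0r add0r.
exact: (@is_derive1_comp R _ (fun h : R => sq3 (h *: v + x)) 0 _ _ df0 ds).
Qed.

Lemma continuous_coord i : continuous (@coord R i).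
Proof.
case: i => [[|[|[|//]]] i3] x; rewrite /coord/=.
- by apply: (@cvg_comp _ _ _ fst fst); exact: cvg_fst.
- by apply: (@cvg_comp _ _ _ fst snd); [exact: cvg_fst|exact: cvg_snd].
- exact: cvg_snd.
Qed.

Lemma continuous_sq3 : continuous sq3.
Proof.
have c2 i : continuous (fun y : P3 R => coord i y ^+ 2).
  move=> x; apply: (@continuous_comp _ _ _ (coord i) (fun y : R => y ^+ 2)).
    exact: continuous_coord.
  exact: exprn_continuous.
have -> : sq3 = fun x => 0 + coord (inord 0) x ^+ 2 + coord (inord 1) x ^+ 2
    + coord (inord 2) x ^+ 2.
  apply/funext => x; rewrite /sq3 !big_ord_recr big_ord0.
  by congr (0 + coord _ x ^+ 2 + coord _ x ^+ 2 + coord _ x ^+ 2);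
     apply/val_inj; rewrite /= inordK.
move=> x; apply: cvgD; last exact: c2.
apply: cvgD; last exact: c2.
by apply: cvgD; [exact: cvg_cst|exact: c2].
Qed.

Lemma radial_poly_derive d F j : 0 < d -> radial_poly d F ->
  exists2 F', radial_poly d F' & forall x, is_derive x (e3 R j) F (F' x).
Proof.
move=> d0.
elim => {F} [i|f /profile_derive[f' pf' df]|f g _ [f' pf' df] _ [g' pg' dg]
  |f g pf [f' pf' df] pg [g' pg' dg]].
- exists (fun=> coord i (e3 R j)); last by move=> x; exact: is_derive_coord.
  by apply: (@radial_poly_profile _ (fun=> _)); exact: profile_cst.
- exists (fun x => f' (sq3 x) * ((2 : R) * coord j x)) => [|x].
    apply: radial_poly_mul; first exact: radial_poly_profile.
    apply: radial_poly_mul; last exact: radial_poly_coord.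
    by apply: (@radial_poly_profile _ (fun=> _)); exact: profile_cst.
  have dfx : is_derive (sq3 x) 1 f (f' (sq3 x)).
    by apply: df; have := sq3_ge0 x; lra.
  have := is_derive_radial (e3 R j) dfx; congr is_derive; congr (_ * _).
  rewrite (bigD1 j)//= big1 ?addr0.
    by rewrite (_ : coord j (e3 R j) = 1) ?mulr1//; case: j => [[|[|[|]]]].
  move=> i ij; rewrite (_ : coord i (e3 R j) = 0) ?mulr0//.
  by move: i j ij => [[|[|[|//]]] ?] [[|[|[|//]]] ?].
- exists (fun x => f' x + g' x); first exact: radial_poly_add.
  by move=> x; have := df x; have := dg x => ? ?; exact: is_deriveD.
- exists (fun x => f x * g' x + g x * f' x).
    by apply: radial_poly_add; exact: radial_poly_mul.
  by move=> x; have := df x; have := dg x => ? ?; exact: is_deriveM.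
Qed.

Lemma radial_poly_continuous d F : 0 < d -> radial_poly d F -> continuous F.
Proof.
move=> d0; elim => {F} [i|f pf|f g _ cf _ cg|f g _ cf _ cg] x.
- exact: continuous_coord.
- apply: (@continuous_comp _ _ _ sq3 f); first exact: continuous_sq3.
  by apply: (profile_continuous pf); have := sq3_ge0 x; lra.
- by apply: cvgD; [exact: cf|exact: cg].
- by apply: cvgM; [exact: cf|exact: cg].
Qed.

(** Every iterated partial stays in the class, so it suffices that members are continuous and have
    partial derivatives. Positivity of [d] keeps [|x|^2] inside the domain []-d, +oo[] of the
    profiles. *)
Lemma radial_poly_smooth d F : 0 < d -> radial_poly d F -> smooth3 F.
Proof.
move=> d0 pF js.
have pjs : radial_poly d (iter_partial js F).
  elim: js => //= j js /(radial_poly_derive j d0)[F' pF' dF].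
  suff -> : partial j (iter_partial js F) = F' by [].
  by apply/funext => x; have := dF x => ?; rewrite /partial derive_val.
split; first exact: (radial_poly_continuous d0).
by move=> j x; have [F' _ /(_ x)[]] := radial_poly_derive j d0 pjs.
Qed.

End smooth_classes.

Section expinv_limits.
Context {R : realType}.

Lemma expinv0_le1 (t : R) : expinv 0 t <= 1.
Proof.
have [t0|t0] := ltP 0 t; last by rewrite expinv_le0E.
by rewrite expinv_gt0E// expr0 invr1 mul1r -expR0 ler_expR oppr_le0 invr_ge0 ltW.
Qed.

(** From [1 + 1 / t <= exp (1 / t)]. As [y * expinv 2 y = expinv 1 y], it bounds the derivative of
    the cutoff times the distance to the end point, uniformly in the cutoff. *)
Lemma expinv1_le1 (t : R) : expinv 1 t <= 1.
Proof.
have [t0|t0] := ltP 0 t; last by rewrite expinv_le0E.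
rewrite expinv_gt0E// expr1 expRN ler_pdivrMr ?expR_gt0// mul1r.
by rewrite (le_trans _ (expR_ge1Dx _))// lerDr.
Qed.

Lemma cvg_expinv0 (y : R) : 0 < y -> expinv 0 (n.+1%:R * y) @[n --> \oo] --> (1 : R).
Proof.
move=> y0.
have -> : (fun n : nat => expinv 0 (n.+1%:R * y)) =
    (fun n => expR (- (y^-1 * @harmonic R n))).
  apply/funext => n; rewrite expinv_gt0E ?mulr_gt0//.
  by rewrite expr0 invr1 mul1r invfM mulrC.
have H : - (y^-1 * @harmonic R n) @[n --> \oo] --> (0 : R).
  rewrite -[X in _ --> X]oppr0 -[X in - X](mulr0 (y^-1)).
  by apply: cvgN; apply: cvgMr; exact: cvg_harmonic.
have c0 : expR x @[x --> (0 : R)] --> (1 : R).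
  by rewrite -[X in _ --> X](@expR0 R); exact: continuous_expR.
exact: (cvg_comp _ _ H c0).
Qed.

(** Up to sign this is the derivative of the cutoff [expinv 0 (c (b - t))] at distance [y] below
    [b]. With [c = n + 1] it equals [y^(-2) c^(-1) exp (- 1 / (c y))], whose factor [1 / c] tends to
    0. *)
Lemma cvg_expinv2 (y : R) : 0 < y ->
  n.+1%:R * expinv 2 (n.+1%:R * y) @[n --> \oo] --> (0 : R).
Proof.
move=> y0.
have -> : (fun n : nat => n.+1%:R * expinv 2 (n.+1%:R * y)) =
    (fun n => y ^- 2 * @harmonic R n * expinv 0 (n.+1%:R * y)).
  apply/funext => n; rewrite !expinv_gt0E ?mulr_gt0//= /harmonic/=.
  have c0 : n.+1%:R != 0 :> R by rewrite pnatr_eq0.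
  move: (n.+1%:R : R) c0 => c c0; field.
  by rewrite c0 gt_eqF.
rewrite -[X in _ --> X](mul0r 1); apply: cvgM; last exact: cvg_expinv0.
rewrite -[X in _ --> X](mulr0 (y ^- 2)).
apply: cvgMr; exact: cvg_harmonic.
Qed.

Lemma measurable_expinv k : measurable_fun setT (@expinv R k).
Proof.
apply: continuous_measurable_fun => t.
by apply: differentiable_continuous; apply/derivable1_diffP; have [] := is_derive_expinv k t.
Qed.

Lemma profile_measurable (d : R) f : profile d f -> measurable_fun setT f.
Proof.
elim => {f} [c||a|k c b|f g _ mf _ mg|f g _ mf _ mg] //.
- apply: (measurableT_comp (measurable_powR a)); exact: measurable_funD.
- apply: (measurableT_comp (measurable_expinv k)); apply: measurable_funM => //.
  exact: measurable_funB.
- exact: measurable_funD.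
- exact: measurable_funM.
Qed.

End expinv_limits.

Section measurability.
Context {R : realType}.
Local Notation T := (measurableTypeR R).
Local Notation TTT := (T * T * T)%type.

Lemma measurable_coord i : measurable_fun (setT : set TTT) (@coord R i).
Proof.
have m1 : measurable_fun (setT : set TTT) (fun x => x.1) by exact: measurable_fst.
case: i => [[|[|[|//]]] i3]; rewrite /coord/=.
- exact: (measurableT_comp measurable_fst m1).
- exact: (measurableT_comp measurable_snd m1).
- exact: measurable_snd.
Qed.

Lemma measurable_sq3 : measurable_fun (setT : set TTT) (@sq3 R).
Proof.
by apply: measurable_sum => i; apply: measurable_funX; exact: measurable_coord.
Qed.

Lemma ball3E (r : R) : 0 < r -> ball3 r = [set x | sq3 x < r ^+ 2].
Proof.
move=> r0; apply/seteqP; split => x; rewrite /ball3 /norm3 /= -/(sq3 x).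
  move=> h; rewrite -(sqr_sqrtr (sq3_ge0 x)) ltr_pXn2r// ?nnegrE ?sqrtr_ge0//.
  exact: ltW.
by move=> h; rewrite -[r]gtr0_norm// -sqrtr_sqr ltr_sqrt// exprn_gt0.
Qed.

Lemma measurable_ball3 (r : R) : 0 < r -> measurable (ball3 r : set TTT).
Proof.
move=> r0; rewrite ball3E//.
rewrite (_ : mkset _ = @sq3 R @^-1` `]-oo, r ^+ 2[%classic); last first.
  by apply/seteqP; split => x /=; rewrite in_itv.
by rewrite -[X in measurable X]setTI; apply: measurable_sq3 => //; exact: measurable_itv.
Qed.

End measurability.

(** * Radial form of the weak equation *)

Section pointwise.
Context {R : realType}.
Variable u : vfield R.

Definition radial_sq (x : P3 R) : R := (\sum_(k < 3) u k x * coord k x) ^+ 2.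

Lemma sum3E (f : 'I_3 -> R) :
  \sum_(i < 3) f i = f (inord 0) + f (inord 1) + f (inord 2).
Proof.
rewrite !big_ord_recr big_ord0 /= add0r.
by congr (f _ + f _ + f _); apply/val_inj; rewrite /= inordK.
Qed.

(** The right side is [|u x x|^2] for the cross product with the position vector. The identity
    yields both the Cauchy-Schwarz bound [radial_sq_le] and the splitting of [W] into normal and
    tangential parts. *)
Lemma lagrange_identity x : sqnorm u x * sq3 x - radial_sq x =
  \sum_(i < 3) cross (fun k => u k x) (fun k => coord k x) i ^+ 2.
Proof. by rewrite /sqnorm /sq3 /radial_sq !sum3E /cross /= !inordK//; ring. Qed.

Lemma sqnorm_ge0 x : 0 <= sqnorm u x.
Proof. by apply: sumr_ge0 => i _; exact: sqr_ge0. Qed.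

Lemma radial_sq_ge0 x : 0 <= radial_sq x.
Proof. exact: sqr_ge0. Qed.

Lemma radial_sq_le x : radial_sq x <= sqnorm u x * sq3 x.
Proof.
rewrite -subr_ge0 lagrange_identity.
by apply: sumr_ge0 => i _; exact: sqr_ge0.
Qed.

Lemma sqnorm_normal_part x :
  sqnorm (normal_part u) x = radial_sq x / sq3 x.
Proof.
have nE : norm3 x ^+ 2 = sq3 x by rewrite /norm3 sqr_sqrtr ?sq3_ge0.
rewrite /sqnorm /normal_part.
under eq_bigr do rewrite exprMn expr_div_n nE.
rewrite -mulr_sumr -mulr_suml -/(sq3 x).
under eq_bigr do rewrite mulrA.
rewrite -mulr_suml exprMn exprVn nE -/(radial_sq x).
(* At the origin both sides vanish, the inverse of 0 being 0. *)
have [->|s0] := eqVneq (sq3 x) 0; first by rewrite !invr0 !mulr0.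
by rewrite divff// mulr1.
Qed.

Lemma sqnorm_tangential_part x : sq3 x != 0 ->
  sqnorm (tangential_part u) x = sqnorm u x - radial_sq x / sq3 x.
Proof.
have nE : norm3 x ^+ 2 = sq3 x by rewrite /norm3 sqr_sqrtr ?sq3_ge0.
move=> s0; apply: (mulIf s0).
rewrite mulrBl divfK// lagrange_identity -nE.
have n0 : norm3 x != 0 by rewrite -sqrf_eq0 nE.
by rewrite /sqnorm /tangential_part !sum3E /cross /= !inordK//; field.
Qed.

End pointwise.

Section weak_identity.
Context {R : realType}.
Local Notation T := (measurableTypeR R).
Local Notation TTT := (T * T * T)%type.
Variable u : vfield R.
Hypothesis u2 : L2loc u.
Hypothesis uE : weak_euler u (fun x => - (sqnorm u x / 2)).
Local Notation W := (sqnorm u).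
Local Notation A := (radial_sq u).
Local Notation leb := (@leb3 R).

Lemma measurable_component i : measurable_fun (setT : set TTT) (u i).
Proof. by have [mu _] := u2 i; exact: mu. Qed.

Lemma measurable_sqnorm : measurable_fun (setT : set TTT) W.
Proof.
by apply: measurable_sum => i; apply: measurable_funX; exact: measurable_component.
Qed.

Lemma measurable_radial_sq : measurable_fun (setT : set TTT) A.
Proof.
apply: measurable_funX; apply: measurable_sum => i.
by apply: measurable_funM; [exact: measurable_component|exact: measurable_coord].
Qed.

Lemma integrable_sqnorm (r : R) : 0 < r ->
  leb.-integrable (ball3 r : set TTT) (fun x => (W x)%:E).
Proof.
move=> r0; apply/integrableP; split.
  by apply/measurable_EFinP; apply: measurable_funTS; exact: measurable_sqnorm.
have mb := measurable_ball3 r0.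
under eq_integral do rewrite gee0_abs ?lee_fin ?sqnorm_ge0//.
under eq_integral do rewrite /sqnorm -sumEFin.
rewrite ge0_integral_sum//.
- by apply: lte_sum_pinfty => i _; have [_ /(_ r r0)] := u2 i.
- move=> i; apply/measurable_EFinP; apply: measurable_funTS; apply: measurable_funX.
  exact: measurable_component.
- by move=> i x _; rewrite lee_fin sqr_ge0.
Qed.

Lemma integrable_bounded_by_sqnorm (r C : R) (f : TTT -> R) : 0 < r ->
  measurable_fun setT f -> (forall x, ball3 r x -> `|f x| <= C * W x) ->
  leb.-integrable (ball3 r : set TTT) (fun x => (f x)%:E).
Proof.
move=> r0 mf fC; have mb := measurable_ball3 r0.
have iC : leb.-integrable (ball3 r : set TTT) (fun x => C%:E * (W x)%:E)%E.
  by apply: integrableZl => //; exact: integrable_sqnorm.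
apply: le_integrable iC => //.
  by apply/measurable_EFinP; exact: measurable_funTS.
move=> x bx; rewrite -EFinM /= lee_fin (le_trans (fC _ bx))// ler_norm//.
Qed.

Lemma partial_radial_field (d : R) (g h : R -> R) i j (x : P3 R) : 0 < d ->
  (forall t, - d < t -> is_derive t 1 g (h t)) ->
  partial j (fun y => coord i y * g (sq3 y)) x =
  (i == j)%:R * g (sq3 x) + 2 * coord i x * coord j x * h (sq3 x).
Proof.
move=> d0 dg.
have cE k l : coord k (e3 R l) = (k == l)%:R.
  by case: k l => [[|[|[|//]]] ?] [[|[|[|//]]] ?].
have dc := is_derive_coord i (e3 R j) x.
have dgx : is_derive (sq3 x) 1 g (h (sq3 x)).
  by apply: dg; have := sq3_ge0 x; lra.
have dr := is_derive_radial (e3 R j) dgx.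
have -> : (fun y => coord i y * g (sq3 y)) =
  (coord i * (fun y => g (sq3 y)) : P3 R -> R) by [].
rewrite /partial derive_val /GRing.scale/= cE (bigD1 j)//= big1 ?addr0; last first.
  by move=> k kj; rewrite cE (negbTE kj) mulr0.
by rewrite cE eqxx mulr1; ring.
Qed.

(** For [phi_i = x_i g(|x|^2)] one has [d_j phi_i = delta_ij g + 2 x_i x_j h]. The flux integrand is
    thus [f1 = W g + 2 A h], the pressure integrand [f2 = (W / 2) (3 g + 2 |x|^2 h)], and the stated
    integrand is [f2 - f1]. Here [b] is the square of the radius of the support. *)
Lemma weak_radial (d : R) (g h : R -> R) (b C : R) : 0 < d -> 0 < b -> profile d g ->
  measurable_fun setT h ->
  (forall t, - d < t -> is_derive t 1 g (h t)) ->
  (forall t, b <= t -> g t = 0 /\ h t = 0) ->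
  (forall t, 0 <= t -> `|g t| <= C /\ `|h t| <= C) ->
  (\int[leb]_(x in ball3 (Num.sqrt b))
    (W x * g (sq3 x) / 2 + h (sq3 x) * (W x * sq3 x - 2 * A x))%:E = 0)%E.
Proof.
move=> d0 b0 pg mh dg gb gC.
set r := Num.sqrt b.
have r0 : 0 < r by rewrite sqrtr_gt0.
have bE x : ball3 r x <-> sq3 x < b.
  by rewrite ball3E// /r /= sqr_sqrtr// ltW.
have mb := measurable_ball3 r0.
pose phi : vfield R := fun i x => coord i x * g (sq3 x).
have tphi : test_field phi.
  split.
    move=> i; apply: (radial_poly_smooth d0); apply: radial_poly_mul.
      exact: radial_poly_coord.
    exact: radial_poly_profile.
  exists r => i x rx; rewrite /phi (gb _ _).1 ?mulr0//.
  by rewrite ltW// ltNge; apply: contraTN rx => /ler_wsqrtr; rewrite -leNgt.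
have := uE tphi.
pose f1 (x : TTT) : R := W x * g (sq3 x) + 2 * A x * h (sq3 x).
pose f2 (x : TTT) : R := W x / 2 * (3 * g (sq3 x) + 2 * sq3 x * h (sq3 x)).
have mgs : measurable_fun (setT : set TTT) (fun x => g (sq3 x)).
  exact: (measurableT_comp (profile_measurable pg) measurable_sq3).
have mhs : measurable_fun (setT : set TTT) (fun x => h (sq3 x)).
  exact: (measurableT_comp mh measurable_sq3).
have mW := measurable_sqnorm; have mA := measurable_radial_sq.
have ms := @measurable_sq3 R.
have -> : (\int[leb]_x (\sum_(i < 3) \sum_(j < 3)
    u i x * u j x * partial j (phi i) x)%:E = \int[leb]_(x in ball3 r) (f1 x)%:E)%E.
  rewrite [RHS]integral_mkcond; apply: eq_integral => x _.
  have -> : \sum_(i < 3) \sum_(j < 3) u i x * u j x * partial j (phi i) x = f1 x.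
    under eq_bigr => i _ do under eq_bigr => j _ do rewrite (partial_radial_field i j x d0 dg).
    rewrite /f1 /sqnorm /radial_sq !sum3E.
    by rewrite -!val_eqE /= !inordK//=; ring.
  rewrite patchE; case: ifPn => //; rewrite notin_setE => /bE/negP.
  by rewrite -leNgt => /gb[gx hx]; rewrite /f1 gx hx !mulr0 addr0.
have -> : (\int[leb]_x (- (W x / 2) * div3 phi x)%:E =
    \int[leb]_(x in ball3 r) (- f2 x)%:E)%E.
  rewrite [RHS]integral_mkcond; apply: eq_integral => x _.
  have -> : - (W x / 2) * div3 phi x = - f2 x.
    rewrite /div3; under eq_bigr => i _ do rewrite (partial_radial_field i i x d0 dg) eqxx.
    rewrite /f2; move: (g (sq3 x)) (h (sq3 x)) => G H; rewrite /sq3 !sum3E /=; ring.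
  rewrite patchE; case: ifPn => //; rewrite notin_setE => /bE/negP.
  by rewrite -leNgt => /gb[gx hx]; rewrite /f2 gx hx !mulr0 addr0 mulr0 oppr0.
have C0 : 0 <= C by have [+ _] := gC _ (lexx 0); exact: le_trans.
(* Both integrals must be finite before they can be subtracted. The estimate [A <= W |x|^2 <= b W]
   on the ball reduces this to the local integrability of [W]. *)
have i1 : leb.-integrable (ball3 r : set TTT) (fun x => (f1 x)%:E).
  apply: (@integrable_bounded_by_sqnorm _ (C + 2 * b * C)) => //.
    apply: measurable_funD; first exact: measurable_funM.
    by apply: measurable_funM => //; exact: measurable_funM.
  move=> x /bE xb; have [gx hx] := gC _ (sq3_ge0 x).
  have := radial_sq_le u x; have := radial_sq_ge0 u x; have := sqnorm_ge0 u x.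
  have := sq3_ge0 x => s0 W0 A0 A1.
  have A20 : 0 <= 2 * A x by lra.
  rewrite (le_trans (ler_normD _ _))// [`|W x * _|]normrM [`|2 * A x * _|]normrM.
  rewrite (ger0_norm W0) (ger0_norm A20).
  have Ab : A x <= W x * b by apply: le_trans A1 _; rewrite ler_wpM2l// ltW.
  have : W x * `|g (sq3 x)| <= W x * C by rewrite ler_wpM2l.
  have : 2 * A x * `|h (sq3 x)| <= 2 * (W x * b) * C by apply: ler_pM => //; lra.
  lra.
have i2 : leb.-integrable (ball3 r : set TTT) (fun x => (f2 x)%:E).
  apply: (@integrable_bounded_by_sqnorm _ (3 * C + 2 * b * C)) => //.
    apply: measurable_funM; first exact: measurable_funM.
    apply: measurable_funD; first exact: measurable_funM.
    by apply: measurable_funM => //; exact: measurable_funM.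
  move=> x /bE xb; have [gx hx] := gC _ (sq3_ge0 x).
  have := sqnorm_ge0 u x; have := sq3_ge0 x => s0 W0.
  rewrite !normrM (ger0_norm W0) mulrC.
  have -> : `|2^-1| = 2^-1 :> R by rewrite ger0_norm.
  have : `|3 * g (sq3 x) + 2 * sq3 x * h (sq3 x)| <= 3 * C + 2 * b * C.
    have s20 : 0 <= 2 * sq3 x by lra.
    have t0 : 0 <= 3 :> R by [].
    rewrite (le_trans (ler_normD _ _))// [`|3 * _|]normrM [`|2 * sq3 x * _|]normrM.
    rewrite (ger0_norm s20) (ger0_norm t0).
    apply: lerD; first by rewrite ler_wpM2l.
    by apply: ler_pM => //; rewrite ler_wpM2l// ltW.
  move=> le1; apply: ler_pM => //; first by rewrite mulr_ge0.
  by rewrite ler_pdivrMr//; lra.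
have -> : (\int[leb]_(x in ball3 r) (- f2 x)%:E = - \int[leb]_(x in ball3 r) (f2 x)%:E)%E.
  have := integralZl mb i2 (-1); rewrite mulN1e => <-.
  by apply: eq_integral => x _; rewrite -EFinM mulN1r.
rewrite oppeK => E12.
transitivity (\int[leb]_(x in ball3 r) ((f2 x)%:E - (f1 x)%:E))%E.
  by apply: eq_integral => x _; rewrite -EFinB; congr EFin; rewrite /f1 /f2; field.
transitivity (\int[leb]_(x in ball3 r) (f2 x)%:E -
  \int[leb]_(x in ball3 r) (f1 x)%:E)%E; first exact: (integralB mb i2 i1).
rewrite E12 subee//.
exact: integrable_fin_num.
Qed.

End weak_identity.

Section radial_limit.
Context {R : realType}.
Local Notation T := (measurableTypeR R).
Local Notation TTT := (T * T * T)%type.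
Variable u : vfield R.
Hypothesis u2 : L2loc u.
Hypothesis uE : weak_euler u (fun x => - (sqnorm u x / 2)).
Local Notation W := (sqnorm u).
Local Notation A := (radial_sq u).
Local Notation leb := (@leb3 R).

(* The cutoff [exp (- 1 / (n (b - t)))] costs nothing in the limit because [v]
   vanishes at [b]: its derivative times [v] is bounded and tends to 0. *)
Lemma weak_radial_limit (d : R) (v v' : R -> R) (b C : R) : 0 < d -> 0 < b ->
  profile d v -> profile d v' ->
  (forall t, - d < t -> is_derive t 1 v (v' t)) ->
  (forall t, 0 <= t -> t < b -> `|v t| <= C * (b - t) /\ `|v' t| <= C) ->
  (\int[leb]_(x in ball3 (Num.sqrt b))
    (W x * v (sq3 x) / 2 + v' (sq3 x) * (W x * sq3 x - 2 * A x))%:E = 0)%E.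
Proof.
move=> d0 b0 pv pv' dv vC.
set r := Num.sqrt b.
have r0 : 0 < r by rewrite sqrtr_gt0.
have bE x : ball3 r x <-> sq3 x < b.
  by rewrite ball3E// /r /= sqr_sqrtr// ltW.
have mb := measurable_ball3 r0.
have C0 : 0 <= C by have [_] := vC _ (lexx 0) b0; exact: le_trans.
pose c n : R := n.+1%:R.
have c0 n : 0 < c n by [].
pose g n t : R := v t * expinv 0 (c n * (b - t)).
pose h n t : R := v' t * expinv 0 (c n * (b - t)) - v t * (c n * expinv 2 (c n * (b - t))).
pose F n (x : TTT) : R := W x * g n (sq3 x) / 2 + h n (sq3 x) * (W x * sq3 x - 2 * A x).
pose F0 (x : TTT) : R := W x * v (sq3 x) / 2 + v' (sq3 x) * (W x * sq3 x - 2 * A x).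
have pg n : profile d (g n) by apply: profile_mul => //; exact: profile_expinv.
have ph n : profile d (h n).
  rewrite (_ : h n = fun t => v' t * expinv 0 (c n * (b - t)) +
     (- c n) * (v t * expinv 2 (c n * (b - t)))); last first.
    by apply/funext => t; rewrite /h; ring.
  apply: profile_add; first by apply: profile_mul => //; exact: profile_expinv.
  apply: profile_mul; first exact: profile_cst.
  by apply: profile_mul => //; exact: profile_expinv.
have dg n t : - d < t -> is_derive t 1 (g n) (h n t).
  move=> td; have d1 := dv _ td; have d2 := is_derive_expinv_affine 0 (c n) b t.
  have := is_deriveM d1 d2.
  by congr (is_derive _ _ _ _); rewrite /h /GRing.scale/=; ring.
have ghb n t : b <= t -> g n t = 0 /\ h n t = 0.
  move=> bt; have cbt : c n * (b - t) <= 0 by rewrite pmulr_rle0// subr_le0.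
  by rewrite /g /h !expinv_le0E// !mulr0 subr0.
have e1 (y : R) : 0 < y -> y * expinv 2 y = expinv 1 y.
  by move=> y0; rewrite -expinvS mulrC divfK// gt_eqF.
have gh n t : 0 <= t -> `|g n t| <= C * b + 2 * C /\ `|h n t| <= C * b + 2 * C.
  have Cb : 0 <= C * b by rewrite mulr_ge0// ltW.
  move=> t0; have [tb|bt] := ltP t b; last first.
    by have [-> ->] := ghb n _ bt; rewrite normr0; lra.
  have [v1 v2] := vC _ t0 tb.
  have bt0 : 0 < b - t by lra.
  have y0 : 0 < c n * (b - t) by rewrite mulr_gt0.
  have vb : C * (b - t) <= C * b by rewrite ler_wpM2l//; lra.
  have E0 := expinv_ge0 0 (c n * (b - t)).
  have E1 := expinv0_le1 (c n * (b - t)).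
  split.
    rewrite /g normrM (ger0_norm E0).
    have : `|v t| * expinv 0 (c n * (b - t)) <= C * (b - t) * 1 by apply: ler_pM.
    by lra.
  rewrite /h (le_trans (ler_normB _ _))// !normrM (ger0_norm E0) (gtr0_norm (c0 n)).
  rewrite (ger0_norm (expinv_ge0 _ _)).
  have : `|v' t| * expinv 0 (c n * (b - t)) <= C * 1 by apply: ler_pM.
  (* The factor [b - t] in the bound on [v] absorbs the growth in [n] of the cutoff's derivative:
     the product is [C * expinv 1 (c n * (b - t))]. *)
  have : `|v t| * (c n * expinv 2 (c n * (b - t))) <= C * 1.
    apply: (@le_trans _ _ (C * (b - t) * (c n * expinv 2 (c n * (b - t))))).
      by rewrite ler_wpM2r// mulr_ge0 ?expinv_ge0// ltW.
    rewrite -mulrA ler_wpM2l// mulrCA mulrA e1//; exact: expinv1_le1.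
  by lra.
(* With [D = C b + 2 C] bounding [g n] and [h n], and [|W |x|^2 - 2 A| <= b W], the integrand is at
   most [D (1/2 + b) W]; [K] is a rounder majorant. *)
pose K := 2 * (C * b + 2 * C) * (1 + b).
have mF f f' : profile d f -> profile d f' -> measurable_fun (setT : set TTT)
    (fun x => W x * f (sq3 x) / 2 + f' (sq3 x) * (W x * sq3 x - 2 * A x)).
  move=> pf pf'.
  have mf := measurableT_comp (profile_measurable pf) (@measurable_sq3 R).
  have mf' := measurableT_comp (profile_measurable pf') (@measurable_sq3 R).
  have mW := measurable_sqnorm u2; have mA := measurable_radial_sq u2.
  apply: measurable_funD.
    by apply: measurable_funM => //; exact: measurable_funM.
  apply: measurable_funM => //; apply: measurable_funB.
    by apply: measurable_funM => //; exact: measurable_sq3.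
  exact: measurable_funM.
have FK n x : ball3 r x -> `|F n x| <= K * W x.
  move=> /bE xb; have [g1 h1] := gh n _ (sq3_ge0 x).
  have := radial_sq_le u x; have := radial_sq_ge0 u x; have := sqnorm_ge0 u x.
  have := sq3_ge0 x => s0 W0 A0 A1.
  have Ab : W x * sq3 x <= W x * b by rewrite ler_wpM2l// ltW.
  have D1 : 0 <= C * b + 2 * C by rewrite addr_ge0// mulr_ge0// ltW.
  have le1 : `|W x * sq3 x - 2 * A x| <= W x * b by rewrite ler_norml; lra.
  rewrite /F (le_trans (ler_normD _ _))// [`|h n _ * _|]normrM normrM.
  rewrite [`|W x * _|]normrM (ger0_norm W0) [`|2^-1|]ger0_norm//.
  have : W x * `|g n (sq3 x)| <= W x * (C * b + 2 * C) by rewrite ler_wpM2l.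
  have : `|h n (sq3 x)| * `|W x * sq3 x - 2 * A x| <= (C * b + 2 * C) * (W x * b).
    by apply: ler_pM.
  have : 0 <= (C * b + 2 * C) * (W x * b) by rewrite mulr_ge0// mulr_ge0// ltW.
  have : 0 <= (C * b + 2 * C) * W x by rewrite mulr_ge0.
  rewrite /K; lra.
have Fcvg x : ball3 r x -> (F n x)%:E @[n --> \oo] --> (F0 x)%:E.
  move=> /bE xb; apply: cvg_EFin; first exact: nearW.
  have y0 : 0 < b - sq3 x by lra.
  have ce0 := cvg_expinv0 y0; have ce2 := cvg_expinv2 y0.
  have cg : g n (sq3 x) @[n --> \oo] --> v (sq3 x).
    by rewrite -[X in _ --> X]mulr1; apply: cvgMr; exact: ce0.
  have ch : h n (sq3 x) @[n --> \oo] --> v' (sq3 x).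
    rewrite -[X in _ --> X]subr0 -{1}[v' (sq3 x)]mulr1 -(mulr0 (v (sq3 x))).
    by apply: cvgB; apply: cvgMr; [exact: ce0|exact: ce2].
  apply: cvgD; last by apply: cvgMl; exact: ch.
  by apply: cvgMl; apply: cvgMr; exact: cg.
have iK : leb.-integrable (ball3 r : set TTT) (fun x => (K * W x)%:E).
  have := integrableZl mb K (integrable_sqnorm u2 r0).
  by apply: eq_integrable => // x _; rewrite EFinM.
have mFn n : measurable_fun (ball3 r : set TTT) (fun x => (F n x)%:E).
  by apply/measurable_EFinP; apply: measurable_funTS; exact: mF.
have mF0 : measurable_fun (ball3 r : set TTT) (fun x => (F0 x)%:E).
  by apply/measurable_EFinP; apply: measurable_funTS; exact: mF.
have FKE x n : ball3 r x -> (`|(F n x)%:E| <= (K * W x)%:E)%E.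
  by move=> bx; rewrite lee_fin; exact: FK.
have Fae : {ae leb, forall x : TTT, ball3 r x -> (F n x)%:E @[n --> \oo] --> (F0 x)%:E}.
  by apply: aeW => x; exact: Fcvg.
have FKae : {ae leb, forall (x : TTT) n, ball3 r x -> (`|(F n x)%:E| <= (K * W x)%:E)%E}.
  by apply: aeW => x n; exact: FKE.
have [_ _ H] := @dominated_convergence _ TTT R leb (ball3 r) mb
  (fun n x => (F n x)%:E) (fun x => (F0 x)%:E) (fun x => (K * W x)%:E)
  mFn mF0 Fae iK FKae.
apply/esym; move: H; rewrite (_ : [sequence _]_n = fun=> 0%E); last first.
  apply/funext => n; apply: (weak_radial u2 uE d0 b0 (pg n) _ (dg n) (ghb n) (gh n)).
  exact: profile_measurable.
by move=> H; apply: (cvg_unique _ _ H) => //; exact: cvg_cst.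
Qed.

End radial_limit.

(** * Identities for the two weights *)

Section energy.
Context {R : realType}.
Local Notation T := (measurableTypeR R).
Local Notation TTT := (T * T * T)%type.
Variable u : vfield R.
Hypothesis u2 : L2loc u.
Hypothesis uE : weak_euler u (fun x => - (sqnorm u x / 2)).
Local Notation W := (sqnorm u).
Local Notation A := (radial_sq u).
Local Notation leb := (@leb3 R).

Lemma powRN_le (s p q : R) : 0 <= s -> 0 < p -> p <= q -> q `^ (- s) <= p `^ (- s).
Proof.
move=> s0 p0 pq; rewrite !powRN lef_pV2 ?posrE ?powR_gt0 ?(lt_le_trans p0)//.
by apply: ge0_ler_powR => //; rewrite nnegrE ltW// (lt_le_trans p0).
Qed.

(** Both choices of [v] make the integrand of [weak_radial_limit] half the difference of a bulk term
    and a multiple of [W]; this turns its vanishing integral into an equation. *)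
Lemma integral_eq_scale (D : set TTT) (f g : TTT -> R) (c : R) : measurable D ->
  leb.-integrable D (fun x => (f x)%:E) -> leb.-integrable D (fun x => (g x)%:E) ->
  (\int[leb]_(x in D) ((f x - c * g x) / 2)%:E = 0)%E ->
  (\int[leb]_(x in D) (f x)%:E = c%:E * \int[leb]_(x in D) (g x)%:E)%E.
Proof.
move=> mD iF iG E.
have iG2 := integrableZl mD c iG.
have h2 : (2 : R)^-1 != 0 by rewrite invr_eq0.
have E2 : (2^-1%:E * \int[leb]_(x in D) ((f x)%:E - c%:E * (g x)%:E) = 0)%E.
  rewrite -integralZl//; last exact: integrableB.
  rewrite -[RHS]E; apply: eq_integral => x _.
  by rewrite [RHS](_ : _ = (2^-1 * (f x - c * g x))%:E)//= mulrC.
move/eqP: E2; rewrite mule_eq0 eqe (negbTE h2)/= => /eqP.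
have -> : (\int[leb]_(x in D) ((f x)%:E - c%:E * (g x)%:E) =
  \int[leb]_(x in D) (f x)%:E - \int[leb]_(x in D) (c%:E * (g x)%:E))%E.
  exact: (integralB mD iF iG2).
have /fineK <- := integrable_fin_num mD iF.
rewrite integralZl//; have /fineK <- := integrable_fin_num mD iG.
by rewrite -EFinM -EFinB => -[/eqP]; rewrite subr_eq0 => /eqP ->.
Qed.

(** With [v t = t - r^2] and [v' = 1] the integrand becomes [(3 W |x|^2 - 4 A - r^2 W) / 2]. *)
Lemma quadratic_identity (r : R) : 0 < r ->
  (\int[leb]_(x in ball3 r) (3 * (W x * sq3 x) - 4 * A x)%:E =
   (r ^+ 2)%:E * \int[leb]_(x in ball3 r) (W x)%:E)%E.
Proof.
move=> r0; have mb := measurable_ball3 r0.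
have b0 : 0 < r ^+ 2 by rewrite exprn_gt0.
have dv (t : R) : - 1 < t -> is_derive t 1 (fun t => t + - r ^+ 2) 1.
  move=> _; have -> : (fun t => t + - r ^+ 2) = id + cst (- r ^+ 2) by [].
  by have := is_deriveD (is_derive_id t 1) (is_derive_cst (- r ^+ 2) t 1); rewrite addr0.
have vC (t : R) : 0 <= t -> t < r ^+ 2 ->
    `|t + - r ^+ 2| <= 1 * (r ^+ 2 - t) /\ `|1 : R| <= 1.
  move=> t0 tb; rewrite mul1r normr1; split => //.
  by rewrite distrC ger0_norm// subr_ge0 ltW.
have := weak_radial_limit u2 uE ltr01 b0
  (profile_add (profile_id 1) (profile_cst 1 (- r ^+ 2))) (profile_cst 1 1) dv vC.
have -> : Num.sqrt (r ^+ 2) = r by rewrite sqrtr_sqr gtr0_norm.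
move=> /= E.
pose f1 (x : TTT) : R := 3 * (W x * sq3 x) - 4 * A x.
have mW := measurable_sqnorm u2; have mA := measurable_radial_sq u2.
have i1 : leb.-integrable (ball3 r : set TTT) (fun x => (f1 x)%:E).
  apply: (@integrable_bounded_by_sqnorm R u u2 _ (3 * r ^+ 2)) => //.
    apply: measurable_funB; apply: measurable_funM => //.
    by apply: measurable_funM => //; exact: measurable_sq3.
  move=> x; rewrite ball3E//= => xb.
  have := radial_sq_le u x; have := radial_sq_ge0 u x; have := sqnorm_ge0 u x.
  have := sq3_ge0 x => s0 W0 A0 A1.
  have Ab : W x * sq3 x <= W x * r ^+ 2 by rewrite ler_wpM2l// ltW.
  by rewrite ler_norml /f1; apply/andP; split; lra.
have iW := integrable_sqnorm u2 r0.
apply: integral_eq_scale => //; rewrite -[RHS]E; apply: eq_integral => x _.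
by congr EFin; field.
Qed.

(** For the unshifted-by-constant part of [v], [(t + d)^(-1/2) / 2 - (t / 2) (t + d)^(-3/2) = (d /
    2) (t + d)^(-3/2)], so [W] enters the bulk term only with the factor [d]; the constant [cb]
    produces the right side. *)
Lemma energy_identity (d r : R) : 0 < d -> 0 < r ->
  (\int[leb]_(x in ball3 r) ((W x * d + 2 * A x) * (sq3 x + d) `^ (- (3 / 2)))%:E =
   ((r ^+ 2 + d) `^ (- (1 / 2)))%:E * \int[leb]_(x in ball3 r) (W x)%:E)%E.
Proof.
move=> d0 r0; have mb := measurable_ball3 r0.
have b0 : 0 < r ^+ 2 by rewrite exprn_gt0.
set b := r ^+ 2 in b0 *.
pose k t : R := (t + d) `^ (- (3 / 2)).
pose cb : R := (b + d) `^ (- (1 / 2)).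
pose v t : R := (t + d) `^ (- (1 / 2)) + - cb.
pose v' t : R := - (1 / 2) * (t + d) `^ (- (1 / 2) - 1).
have v'E t : v' t = - (1 / 2) * k t.
  by rewrite /v' /k; congr (_ * _ `^ _); lra.
have pv : profile d v by apply: profile_add; [exact: profile_pow|exact: profile_cst].
have pv' : profile d v' by apply: profile_mul; [exact: profile_cst|exact: profile_pow].
have dv t : - d < t -> is_derive t 1 v (v' t).
  move=> td; have td0 : 0 < t + d by lra.
  have dp := @is_derive1_powR R (- (1 / 2)) _ td0.
  have ds : is_derive t 1 (id + cst d) 1.
    by have := is_deriveD (is_derive_id t 1) (is_derive_cst d t 1); rewrite addr0.
  have dc := @is_derive1_comp R _ (id + cst d) t _ _ dp ds.
  have -> : v = ((@powR R ^~ (- (1 / 2))) \o (id + cst d)) + cst (- cb) by [].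
  by have := is_deriveD dc (is_derive_cst (- cb) t 1); rewrite addr0 mulr1.
(* [C] is the value of [|v'|] at 0, its maximum over [t >= 0]. Since [v b = 0], the mean value
   theorem then gives [|v t| <= C (b - t)]. *)
pose C : R := 1 / 2 * d `^ (- (3 / 2)).
have v'C t : 0 <= t -> `|v' t| <= C.
  have h12 : 0 <= 1 / 2 :> R by lra.
  move=> t0; rewrite v'E normrM normrN (ger0_norm h12) (ger0_norm (powR_ge0 _ _)).
  by rewrite ler_wpM2l//; apply: powRN_le => //; lra.
have vC t : 0 <= t -> t < b -> `|v t| <= C * (b - t) /\ `|v' t| <= C.
  move=> t0 tb; split; last exact: v'C.
  have [|c|c ctb E] := @MVT R v v' t b tb.
  - by move=> x; rewrite in_itv/= => /andP[? ?]; apply: dv; lra.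
  - apply: continuous_in_subspaceT => x; rewrite inE/= in_itv/= => /andP[? ?].
    by apply: (profile_continuous pv); lra.
  have vb : v b = 0 by rewrite /v /cb subrr.
  move: E; rewrite vb sub0r => E; rewrite -normrN E normrM (@ger0_norm _ (b - t)); last by lra.
  rewrite ler_wpM2r//; first by lra.
  by apply: v'C; move: ctb; rewrite in_itv/= => /andP[? ?]; lra.
have := weak_radial_limit u2 uE d0 b0 pv pv' dv vC.
have -> : Num.sqrt b = r by rewrite sqrtr_sqr gtr0_norm.
move=> E.
pose f1 (x : TTT) : R := (W x * d + 2 * A x) * k (sq3 x).
have mW := measurable_sqnorm u2; have mA := measurable_radial_sq u2.
have i1 : leb.-integrable (ball3 r : set TTT) (fun x => (f1 x)%:E).
  apply: (@integrable_bounded_by_sqnorm R u u2 _ ((d + 2 * b) * d `^ (- (3 / 2)))) => //.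
    apply: measurable_funM; first by apply: measurable_funD; exact: measurable_funM.
    exact: (measurableT_comp (profile_measurable (profile_pow d (- (3 / 2)))) (@measurable_sq3 R)).
  move=> x; rewrite ball3E//= => xb.
  have := radial_sq_le u x; have := radial_sq_ge0 u x; have := sqnorm_ge0 u x.
  have := sq3_ge0 x => s0 W0 A0 A1.
  have Ab : W x * sq3 x <= W x * b by rewrite ler_wpM2l// ltW.
  have Wd : 0 <= W x * d by rewrite mulr_ge0// ltW.
  rewrite /f1 normrM !ger0_norm ?powR_ge0//; last by lra.
  rewrite mulrAC; apply: ler_pM; rewrite ?powR_ge0//; [lra|lra|].
  by apply: powRN_le => //; lra.
have iW := integrable_sqnorm u2 r0.
apply: integral_eq_scale => //; rewrite -[RHS]E; apply: eq_integral => x _.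
congr EFin; rewrite v'E /v -/(k _) -/cb.
have td : 0 < sq3 x + d by have := sq3_ge0 x; lra.
have -> : (sq3 x + d) `^ (- (1 / 2)) = (sq3 x + d) * k (sq3 x).
  rewrite /k -{2}(powRr1 (ltW td)) -powRD; first by congr (_ `^ _); lra.
  by apply/implyP => _; rewrite gt_eqF.
by field.
Qed.

Lemma powRN_half_le (d r : R) : 0 < d -> 0 < r -> (r ^+ 2 + d) `^ (- (1 / 2)) <= r^-1.
Proof.
move=> d0 r0.
have -> : r^-1 = (r ^+ 2) `^ (- (1 / 2)).
  by rewrite powRN mul1r powR12_sqrt ?sqr_ge0// sqrtr_sqr gtr0_norm.
by apply: powRN_le; rewrite ?exprn_gt0//; lra.
Qed.

End energy.

(** * The normal energy bound and the growth bound *)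

Section inequalities.
Context {R : realType}.
Local Notation T := (measurableTypeR R).
Local Notation TTT := (T * T * T)%type.
Variable u : vfield R.
Hypothesis u2 : L2loc u.
Hypothesis uE : weak_euler u (fun x => - (sqnorm u x / 2)).
Local Notation W := (sqnorm u).
Local Notation A := (radial_sq u).
Local Notation leb := (@leb3 R).

Let mk d a : measurable_fun (setT : set TTT) (fun x => (sq3 x + d) `^ a : R).
Proof.
exact: (measurableT_comp (profile_measurable (profile_pow d a)) (@measurable_sq3 R)).
Qed.

Let weight_ge0 (d : R) x : 0 < d ->
  0 <= (W x * d + 2 * A x) * (sq3 x + d) `^ (- (3 / 2)).
Proof.
move=> d0; rewrite mulr_ge0 ?powR_ge0//.
have : 0 <= W x * d by rewrite mulr_ge0 ?sqnorm_ge0// ltW.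
by have := radial_sq_ge0 u x; lra.
Qed.

Let integral_sqnorm_ge0 (r : R) : (0 <= \int[leb]_(x in ball3 r) (W x)%:E)%E.
Proof. by apply: integral_ge0 => x _; rewrite lee_fin sqnorm_ge0. Qed.

Lemma regularized_normal_energy (d r : R) : 0 < d -> 0 < r ->
  (\int[leb]_(x in ball3 r) (A x * (sq3 x + d) `^ (- (3 / 2)))%:E <=
   (2 * r)^-1%:E * \int[leb]_(x in ball3 r) (W x)%:E)%E.
Proof.
move=> d0 r0; have mb := measurable_ball3 r0.
have mW := measurable_sqnorm u2; have mA := measurable_radial_sq u2.
have pos x : 0 <= (W x * d + 2 * A x) * (sq3 x + d) `^ (- (3 / 2)).
  exact: weight_ge0.
apply: (@le_trans _ _ (2^-1%:E * \int[leb]_(x in ball3 r)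
    ((W x * d + 2 * A x) * (sq3 x + d) `^ (- (3 / 2)))%:E)%E).
  have mf : measurable_fun (ball3 r : set TTT)
      (fun x => ((W x * d + 2 * A x) * (sq3 x + d) `^ (- (3 / 2)))%:E).
    apply/measurable_EFinP; apply: measurable_funTS; apply: measurable_funM => //.
    by apply: measurable_funD; exact: measurable_funM.
  rewrite -ge0_integralZl//; last first.
    by move=> x _; rewrite lee_fin.
  apply: ge0_le_integral => //.
  - by move=> x _; rewrite lee_fin (mulr_ge0 (radial_sq_ge0 u x)) ?powR_ge0.
  - by apply/measurable_EFinP; apply: measurable_funTS; exact: measurable_funM.
  - exact: measurable_funeM.
  move=> x _; rewrite -EFinM lee_fin mulrA ler_wpM2r ?powR_ge0//.
  have : 0 <= W x * d by rewrite mulr_ge0 ?sqnorm_ge0// ltW.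
  by lra.
rewrite (energy_identity u2 uE d0 r0) muleA; apply: lee_wpmul2r => //.
rewrite -EFinM lee_fin invfM ler_wpM2l//; exact: powRN_half_le.
Qed.

Lemma powRN32 (t : R) : 0 < t -> t `^ (- (3 / 2)) = (t * Num.sqrt t)^-1.
Proof.
move=> t0; rewrite powRN; congr (_^-1).
rewrite -powR12_sqrt ?ltW// -{2}(powRr1 (ltW t0)) -powRD; last first.
  by apply/implyP => _; rewrite gt_eqF.
by congr (_ `^ _); lra.
Qed.

(** The integrand is [A |x|^(-3)], the increasing limit of [A (|x|^2 + d)^(-3/2)] along
    [d = 1 / (n + 1)]. The regularized bound does not depend on [d], so monotone convergence carries
    it over. *)
Lemma normal_energy (r : R) : 0 < r ->
  (\int[leb]_(x in ball3 r) (sqnorm (normal_part u) x / norm3 x)%:E <=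
   (2 * r)^-1%:E * \int[leb]_(x in ball3 r) (W x)%:E)%E.
Proof.
move=> r0; have mb := measurable_ball3 r0.
have mA := measurable_radial_sq u2.
pose d n : R := @harmonic R n.
have d0 n : 0 < d n by rewrite /d /harmonic/= invr_gt0.
pose f n (x : TTT) := (A x * (sq3 x + d n) `^ (- (3 / 2)))%:E.
have fcvg x : f n x @[n --> \oo] --> (sqnorm (normal_part u) x / norm3 x)%:E.
  apply: cvg_EFin; first exact: nearW.
  rewrite sqnorm_normal_part /f/=.
  (* At the origin [A] vanishes, so every term of the sequence and its limit are 0. *)
  have [t0|t0] := ltP 0 (sq3 x); last first.
    have t00 : sq3 x = 0 by apply/le_anti; rewrite t0 sq3_ge0.
    have A0 : A x = 0.
      apply/le_anti; rewrite radial_sq_ge0 andbT (le_trans (radial_sq_le u x))//.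
      by rewrite t00 mulr0.
    rewrite A0 !mul0r; under eq_fun do rewrite /= mul0r; exact: cvg_cst.
  rewrite -mulrA -invfM -(powRN32 t0); apply: cvgMr.
  have ct : (sq3 x + d n) @[n --> \oo] --> sq3 x.
    by rewrite -[X in _ --> X]addr0; apply: cvgD; [exact: cvg_cst|exact: cvg_harmonic].
  have cp : {for sq3 x, continuous (@powR R ^~ (- (3 / 2)))}.
    apply: differentiable_continuous; apply/derivable1_diffP.
    by have [] := @is_derive1_powR R (- (3 / 2)) _ t0.
  exact: (cvg_comp _ _ ct cp).
have mf n : measurable_fun (ball3 r : set TTT) (f n).
  by apply/measurable_EFinP; apply: measurable_funTS; exact: measurable_funM.
have f0 n x : ball3 r x -> (0 <= f n x)%E.
  by move=> _; rewrite lee_fin (mulr_ge0 (radial_sq_ge0 u x)) ?powR_ge0.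
have nd x : ball3 r x -> {homo f ^~ x : n m / (n <= m)%N >-> (n <= m)%E}.
  move=> _ n m nm; rewrite lee_fin ler_wpM2l ?radial_sq_ge0//.
  apply: powRN_le; [by []|have := sq3_ge0 x; have := d0 m; lra|].
  rewrite lerD2l /d /harmonic/= lef_pV2 ?posrE// ler_nat ltnS//.
have H := cvg_monotone_convergence (mu := leb) mb mf f0 nd.
rewrite (_ : (\int[_]_(_ in _) _)%E = (\int[leb]_(x in ball3 r) limn (f ^~ x))%E); last first.
  by apply: eq_integral => x _; apply/esym/cvg_lim => //; exact: fcvg.
rewrite -(cvg_lim _ H)//; apply: lime_le.
  by apply/cvg_ex; eexists; exact: H.
by apply: nearW => n; exact: regularized_normal_energy.
Qed.

(** On the ball of radius [e], [|x|^2 + e^2 <= 2 e^2], so the term [d W] with [d = e^2] has weight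
    at least the constant on the left. That constant does not depend on [r], so [r] can later run to
    infinity with [e] fixed. *)
Lemma energy_growth (e r : R) : 0 < e -> e <= r ->
  ((e ^+ 2 * (2 * e ^+ 2) `^ (- (3 / 2)))%:E * \int[leb]_(x in ball3 e) (W x)%:E <=
   r^-1%:E * \int[leb]_(x in ball3 r) (W x)%:E)%E.
Proof.
move=> e0 er; have r0 : 0 < r by exact: lt_le_trans er.
have d0 : 0 < e ^+ 2 by rewrite exprn_gt0.
have [mb me] := (measurable_ball3 r0, measurable_ball3 e0).
have mW := measurable_sqnorm u2; have mA := measurable_radial_sq u2.
set d := e ^+ 2 in d0 *.
pose f (x : TTT) : R := (W x * d + 2 * A x) * (sq3 x + d) `^ (- (3 / 2)).
have f0 x : 0 <= f x.
  exact: weight_ge0.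
have mf (D : set TTT) : measurable_fun D (fun x => (f x)%:E).
  apply/measurable_EFinP; apply: measurable_funTS; apply: measurable_funM => //.
  by apply: measurable_funD; exact: measurable_funM.
apply: (@le_trans _ _ (\int[leb]_(x in ball3 r) (f x)%:E)%E); last first.
  rewrite (energy_identity u2 uE d0 r0); apply: lee_wpmul2r => //.
  by rewrite lee_fin; exact: powRN_half_le.
apply: (@le_trans _ _ (\int[leb]_(x in ball3 e) (f x)%:E)%E); last first.
  apply: ge0_subset_integral => //; first by move=> x _; rewrite lee_fin.
  by move=> x /= xe; exact: lt_le_trans er.
rewrite -ge0_integralZl//; last 3 first.
- by apply/measurable_EFinP; exact: measurable_funTS.
- by move=> x _; rewrite lee_fin sqnorm_ge0.
- by rewrite lee_fin mulr_ge0 ?powR_ge0// ltW.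
apply: ge0_le_integral => //.
- by move=> x _; rewrite -EFinM lee_fin !mulr_ge0 ?powR_ge0 ?sqnorm_ge0// ltW.
- apply: measurable_funeM; apply/measurable_EFinP; exact: measurable_funTS.
move=> x; rewrite ball3E//= -/d => xd; rewrite -EFinM lee_fin /f.
have W0 := sqnorm_ge0 u x; have A0 := radial_sq_ge0 u x; have s0 := sq3_ge0 x.
have Wd : 0 <= d * W x by rewrite mulr_ge0// ltW.
rewrite mulrAC; apply: ler_pM => //; [exact: powR_ge0|lra|].
by apply: powRN_le; lra.
Qed.

End inequalities.

(** * Sphere integrals and differentiation in the radius *)

Section sphere_integrals.
Context {R : realType}.
Local Notation T := (measurableTypeR R).
Local Notation TTT := (T * T * T)%type.
Local Notation leb := (@leb3 R).
Local Notation mu := (@lebesgue_measure R).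
Let D : set (T * T) := `[0%R, pi]%classic `*` `[0%R, (2 * pi)%R]%classic.

Let mD : measurable D.
Proof. by apply: measurableX; exact: measurable_itv. Qed.

Let msphf (f : TTT -> R) : measurable_fun setT f -> measurable_fun
  (setT : set (T * (T * T))) (fun w => (f (sph w.1 w.2) * w.1 ^+ 2 * sin w.2.1)%:E).
Proof.
move=> mf.
have m1 : measurable_fun (setT : set (T * (T * T))) (fun w => w.1) by exact: measurable_fst.
have m2 : measurable_fun (setT : set (T * (T * T))) (fun w => w.2) by exact: measurable_snd.
have m21 := measurableT_comp measurable_fst m2.
have m22 := measurableT_comp measurable_snd m2.
have ms := measurableT_comp measurable_sin m21.
apply/measurable_EFinP; apply: measurable_funM => //; apply: measurable_funM.
  apply: (measurableT_comp mf); apply: measurable_fun_pair; last first.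
    by apply: measurable_funM => //; exact: (measurableT_comp measurable_cos m21).
  apply: measurable_fun_pair; apply: measurable_funM; try (exact: measurable_funM).
    exact: (measurableT_comp measurable_cos m22).
  exact: (measurableT_comp measurable_sin m22).
exact: measurable_funX.
Qed.

Let integrand_ge0 (f : TTT -> R) s z : (forall x, 0 <= f x) -> D z ->
  (0 <= (f (sph s z) * s ^+ 2 * sin z.1)%:E)%E.
Proof.
move=> f0 [/=]; rewrite in_itv/= => z1 _.
by rewrite lee_fin mulr_ge0 ?sin_ge0_pi// mulr_ge0 ?sqr_ge0.
Qed.

Lemma sphere_integral_ge0 (f : TTT -> R) s : (forall x, 0 <= f x) ->
  (0 <= sphere_integral s f)%E.
Proof. by move=> f0; apply: integral_ge0 => z Dz; exact: integrand_ge0. Qed.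

Lemma measurable_sphere_integral (f : TTT -> R) :
  measurable_fun setT f -> (forall x, 0 <= f x) ->
  measurable_fun (setT : set T) (fun s => sphere_integral s f).
Proof.
move=> mf f0.
apply: (@measurable_integral_in1 _ _ T (T * T)%type R leb2 setT D _ measurableT mD (msphf mf)).
by move=> s z _ Dz; exact: integrand_ge0.
Qed.

Lemma sq3_sph (r : R) z : sq3 (sph r z) = r ^+ 2.
Proof.
rewrite /sq3 sum3E /coord /= !inordK//=.
have := cos2Dsin2 z.1; have := cos2Dsin2 z.2 => E2 E1.
transitivity (r ^+ 2 * (sin z.1 ^+ 2 * (cos z.2 ^+ 2 + sin z.2 ^+ 2) + cos z.1 ^+ 2)).
  by ring.
by rewrite E2 mulr1 addrC E1 mulr1.
Qed.

(** The pointwise relation is required only on the sphere, where [|x|^2] is the constant [s^2].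
    Writing it as a sum of nonnegative terms avoids any finiteness condition. *)
Lemma sphere_integral_lin (f g h : TTT -> R) (s c : R) : 0 <= c ->
  measurable_fun setT g -> measurable_fun setT h ->
  (forall x, 0 <= g x) -> (forall x, 0 <= h x) ->
  (forall x, sq3 x = s ^+ 2 -> f x = g x + c * h x) ->
  (sphere_integral s f = sphere_integral s g + c%:E * sphere_integral s h)%E.
Proof.
move=> c0 mg mh g0 h0 E; rewrite /sphere_integral.
have mS (k : TTT -> R) : measurable_fun setT k -> measurable_fun D
    (fun z => (k (sph s z) * s ^+ 2 * sin z.1)%:E).
  move=> mk; apply: measurable_funTS; exact: (measurable_fun_pair2 (s : T) (msphf mk)).
rewrite -ge0_integralZl//; [|exact: mS|by move=> z Dz; exact: integrand_ge0].
rewrite -ge0_integralD//; last 4 first.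
- by move=> z Dz; exact: integrand_ge0.
- exact: mS.
- by move=> z Dz; rewrite mule_ge0// ?lee_fin//; exact: (integrand_ge0 s h0 Dz).
- by apply: measurable_funeM; exact: mS.
apply: eq_integral => z _; rewrite -EFinM -EFinD E ?sq3_sph//; congr EFin; ring.
Qed.

(** Spherical coordinates for [g] extended by zero off the ball: on the sphere of radius [s] the
    extension is [g] or 0 according to whether [s < r]. *)
Lemma integral_ball_polar (g : TTT -> R) (r : R) : 0 < r ->
  measurable_fun setT g -> (forall x, 0 <= g x) ->
  (\int[leb]_(x in ball3 r) (g x)%:E =
   \int[mu]_(s in `]0%R, r]) sphere_integral s g)%E.
Proof.
move=> r0 mg g0; have mb := measurable_ball3 r0.
have mgs := measurable_sphere_integral mg g0.
rewrite -integral_itv_bndo_bndc; last exact: measurable_funTS.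
pose f : TTT -> R := g \_ (ball3 r : set TTT).
have mf : measurable_fun setT f.
  by apply/(measurable_restrictT _ _).1 => //; exact: measurable_funTS.
have f0 x : 0 <= f x by rewrite /f patchE; case: ifP.
transitivity (\int[leb]_x (f x)%:E)%E.
  rewrite integral_mkcond; apply: eq_integral => x _.
  by rewrite /f !patchE; case: ifP.
rewrite (spherical_coordinates mf f0) integral_mkcond [RHS]integral_mkcond.
apply: eq_integral => s _; rewrite !patchE !mem_setE !in_itv/= andbT.
have [s0|//] := ltP 0 s; have [sr|rs] := ltP s r => /=.
  apply: eq_integral => z _; rewrite /f patchE mem_set//.
  by rewrite ball3E//= sq3_sph ltr_pXn2r// ?nnegrE ltW.
rewrite /sphere_integral integral0_eq// => z _.
rewrite /f patchE memNset ?mul0r// ball3E//= sq3_sph ltNge => /negP; apply.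
by rewrite ler_pXn2r// ?nnegrE ltW// (lt_le_trans r0).
Qed.

Section ae_derivative.
Variable g : TTT -> R.
Hypothesis mg : measurable_fun setT g.
Hypothesis g0 : forall x, 0 <= g x.
Hypothesis ig : forall r : R, 0 < r -> (\int[leb]_(x in ball3 r) (g x)%:E < +oo)%E.

Let gs (s : T) : \bar R := sphere_integral s g.

Let mgs : measurable_fun setT gs.
Proof. exact: measurable_sphere_integral. Qed.

Let gs0 s : (0 <= gs s)%E.
Proof. exact: sphere_integral_ge0. Qed.

Let igs (r : R) : 0 < r -> mu.-integrable `]0%R, r] gs.
Proof.
move=> r0; apply/integrableP; split; first exact: measurable_funTS.
under eq_integral do rewrite gee0_abs//.
by rewrite -integral_ball_polar// ig.
Qed.

(** By the polar formula the sphere integrals are integrable on each []0, n + 1]], hence finite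
    almost everywhere there; countably many such intervals cover all radii. *)
Lemma ae_sphere_integral_fin_num :
  {ae mu, forall s : T, 0 < s -> sphere_integral s g \is a fin_num}.
Proof.
have H n : {ae mu, forall s : T, `]0%R, n.+1%:R]%classic s -> gs s \is a fin_num}.
  by apply: integrable_ae; [exact: measurable_itv|exact: igs].
have := ae_foralln H; apply: filterS => s Hs s0.
apply: (Hs (Num.bound s)); rewrite /= in_itv/= s0 ltW//.
by rewrite (lt_trans (archi_boundP (ltW s0)))// ltr_nat.
Qed.

(** A real-valued density on the whole line, as differentiation of integrals asks. The radii where
    [fine] replaces an infinite value by 0 form a null set. *)
Let f : R -> R := (fun s => fine (gs s)) \_ `]0%R, +oo[%classic.

Let mf : measurable_fun (setT : set T) f.
Proof.
apply/(measurable_restrictT _ _).1; first exact: measurable_itv.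
by apply: measurable_funTS; exact: (measurableT_comp _ mgs).
Qed.

Let f0 s : 0 <= f s.
Proof. by rewrite /f patchE; case: ifP => // _; exact: fine_ge0. Qed.

Let fint (r : R) : 0 < r ->
  (\int[mu]_(s in `]0%R, r]) (f s)%:E = \int[leb]_(x in ball3 r) (g x)%:E)%E.
Proof.
move=> r0; rewrite integral_ball_polar//; apply: ge0_ae_eq_integral.
- exact: measurable_itv.
- by apply/measurable_EFinP; exact: measurable_funTS.
- exact: measurable_funTS.
- by move=> s _; rewrite lee_fin.
- by move=> s _; exact: gs0.
have := ae_sphere_integral_fin_num; apply: filterS => s Hs.
rewrite /= in_itv/= => /andP[s0 sr].
by rewrite /f patchE mem_set ?fineK ?Hs//= in_itv/= s0.
Qed.

Let fintegrable (y : R) : mu.-integrable `]0%R, y] (EFin \o f).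
Proof.
apply/integrableP; split.
  by apply/measurable_EFinP; exact: measurable_funTS.
under eq_integral do rewrite gee0_abs ?lee_fin ?f0//.
have [y0|y0] := ltP 0 y; first by rewrite fint// ig.
by rewrite set_itv_ge ?integral_set0// bnd_simp -leNgt.
Qed.

Let floc : locally_integrable [set: R] f.
Proof.
split; [exact: mf|exact: openT|move=> K _ cK].
have [M [_ HM]] := compact_bounded cK.
pose m := Num.max 1 (M + 1).
have m0 : 0 < m by rewrite /m lt_max ltr01.
(* The left end is lowered by one because the interval is open there; nothing is added, as [f]
   vanishes on [s <= 0]. *)
have Km : K `<=` `]- m - 1, m]%classic.
  move=> x Kx; have : `|x| <= m.
    by apply: HM => //; rewrite /m lt_max ltrDl ltr01 orbT.
  rewrite ler_norml /= in_itv/= => /andP[? ?]; apply/andP; split => //; lra.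
apply: (@le_lt_trans _ _ (\int[mu]_(s in `](- m - 1)%R, m]) `|f s|%:E)%E).
  apply: ge0_subset_integral => //; first exact: compact_measurable.
  by apply/measurable_EFinP; apply: measurable_funTS; exact: measurableT_comp.
have -> : (\int[mu]_(s in `](- m - 1)%R, m]) `|f s|%:E = \int[mu]_(s in `]0%R, m]) (f s)%:E)%E.
  rewrite integral_mkcond [RHS]integral_mkcond; apply: eq_integral => s _.
  rewrite !patchE !mem_setE !in_itv/= ger0_norm//.
  have [s0|s0] := ltP 0 s; first by have -> : - m - 1 < s by lra.
  by rewrite /= /f patchE memNset//= ?if_same// in_itv/= ltNge s0.
by rewrite fint// ig.
Qed.

(** By the polar formula the ball integral is a primitive of [f], so Lebesgue differentiation
    applies at almost every radius. *)
Lemma ae_is_derive_ball_integral : {ae mu, forall s : T, 0 < s ->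
  is_derive (s : R) 1 (fun y : R => fine (\int[leb]_(x in ball3 y) (g x)%:E)%E)
    (fine (sphere_integral s g))}.
Proof.
have := FTC1 fintegrable floc.
apply: filterS; first exact: (ae_filter_ringOfSetsType mu).
move=> s Hs s0.
have [//|ds Es] := Hs.
have fs : f s = fine (sphere_integral s g).
  by rewrite /f patchE mem_set//= in_itv/= s0.
have dF : is_derive (s : R) 1 (fun x : R => (\int[mu]_(t in `]0%R, x]) f t)%R)
    (fine (sphere_integral s g)).
  by rewrite -fs -Es derive1E; exact: derivableP.
apply: near_eq_is_derive dF.
near=> y; have y0 : 0 < y by near: y; exact: lt_nbhsr.
by rewrite /Rintegral fint.
Unshelve. all: by end_near.
Qed.

End ae_derivative.
End sphere_integrals.

(** * Vanishing of the field *)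

Section liouville.
Context {R : realType}.
Local Notation T := (measurableTypeR R).
Local Notation TTT := (T * T * T)%type.
Variable u : vfield R.
Hypothesis u2 : L2loc u.
Hypothesis uE : weak_euler u (fun x => - (sqnorm u x / 2)).
Local Notation W := (sqnorm u).
Local Notation A := (radial_sq u).
Local Notation leb := (@leb3 R).
Local Notation mu := (@lebesgue_measure R).

(** Let [w], [q], [tau] be the sphere integrals of [W], [A], [|u_T|^2]. Differentiating
    [r^2 F = 3 P - 4 Q], with [|x|^2 = s^2] on the sphere, gives [2 s F + s^2 w = 3 s^2 w - 4 q].
    Since [w = tau + q / s^2], this is [F = s tau - q / s <= s tau]. *)
Lemma ae_energy_le_tangential : {ae mu, forall s : T, 0 < s ->
  (\int[leb]_(x in ball3 s) (W x)%:E <=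
   s%:E * sphere_integral s (sqnorm (tangential_part u)))%E}.
Proof.
have mW := measurable_sqnorm u2; have mA := measurable_radial_sq u2.
have W0 := sqnorm_ge0 u; have A0 := radial_sq_ge0 u.
pose V (x : TTT) : R := W x * sq3 x.
have mV : measurable_fun setT V by apply: measurable_funM => //; exact: measurable_sq3.
have V0 x : 0 <= V x by rewrite mulr_ge0 ?sq3_ge0.
have iW r : 0 < r -> leb.-integrable (ball3 r : set TTT) (fun x => (W x)%:E).
  exact: integrable_sqnorm.
have iV r : 0 < r -> leb.-integrable (ball3 r : set TTT) (fun x => (V x)%:E).
  move=> r0; apply: (@integrable_bounded_by_sqnorm R u u2 _ (r ^+ 2)) => // x.
  by rewrite ball3E//= => xb; rewrite ger0_norm// /V mulrC ler_wpM2r// ltW.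
have iA r : 0 < r -> leb.-integrable (ball3 r : set TTT) (fun x => (A x)%:E).
  move=> r0; apply: (@integrable_bounded_by_sqnorm R u u2 _ (r ^+ 2)) => // x.
  rewrite ball3E//= => xb; rewrite ger0_norm// (le_trans (radial_sq_le u x))//.
  by rewrite mulrC ler_wpM2r// ltW.
have lty (g : TTT -> R) : (forall x, 0 <= g x) ->
    (forall r, 0 < r -> leb.-integrable (ball3 r : set TTT) (fun x => (g x)%:E)) ->
    forall r, 0 < r -> (\int[leb]_(x in ball3 r) (g x)%:E < +oo)%E.
  move=> g0 ig r r0; have /integrableP[_] := ig _ r0.
  by under eq_integral do rewrite gee0_abs ?lee_fin//.
pose F y := fine (\int[leb]_(x in ball3 y) (W x)%:E)%E.
pose P y := fine (\int[leb]_(x in ball3 y) (V x)%:E)%E.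
pose Q y := fine (\int[leb]_(x in ball3 y) (A x)%:E)%E.
have FPQ y : 0 < y -> y ^+ 2 * F y = 3 * P y - 4 * Q y.
  move=> y0; have mb := measurable_ball3 y0.
  have := quadratic_identity u2 uE y0.
  have -> : (\int[leb]_(x in ball3 y) (3 * (W x * sq3 x) - 4 * A x)%:E =
      \int[leb]_(x in ball3 y) (3%:E * (V x)%:E) -
      \int[leb]_(x in ball3 y) (4%:E * (A x)%:E))%E.
    exact: (integralB mb (integrableZl mb 3 (iV _ y0)) (integrableZl mb 4 (iA _ y0))).
  rewrite !integralZl//; [|exact: iA|exact: iV].
  have /fineK <- := integrable_fin_num mb (iW _ y0).
  have /fineK <- := integrable_fin_num mb (iV _ y0).
  have /fineK <- := integrable_fin_num mb (iA _ y0).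
  by rewrite -!EFinM -EFinB => -[->].
(* [G] equals [|u_T|^2] off the origin and is measurable and nonnegative everywhere, as
   [sphere_integral_lin] asks. *)
pose G (x : TTT) : R := W x - A x * (sq3 x)^-1.
have mG : measurable_fun setT G.
  apply: measurable_funB => //; apply: measurable_funM => //.
  exact: (measurableT_comp measurable_invr (@measurable_sq3 R)).
have G0 x : 0 <= G x.
  rewrite /G subr_ge0; have [t0|t0] := ltP 0 (sq3 x).
    by rewrite ler_pdivrMr//; exact: radial_sq_le.
  have -> : sq3 x = 0 by apply/le_anti; rewrite t0 sq3_ge0.
  by rewrite invr0 mulr0.
have aF := ae_is_derive_ball_integral mW W0 (lty _ W0 iW).
have aP := ae_is_derive_ball_integral mV V0 (lty _ V0 iV).
have aQ := ae_is_derive_ball_integral mA A0 (lty _ A0 iA).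
have fW := ae_sphere_integral_fin_num mW W0 (lty _ W0 iW).
have fA := ae_sphere_integral_fin_num mA A0 (lty _ A0 iA).
move: fA; apply: filterS2 (filterI fW (filterI aF (filterI aP aQ))) => s [fW' [dF [dP dQ]]] fA' s0.
move: (fW' s0) (fA' s0) (dF s0) (dP s0) (dQ s0) => {fW' fA' dF dP dQ}.
rewrite -/(F _) -/(P _) -/(Q _).
have EV : sphere_integral s V = ((s ^+ 2)%:E * sphere_integral s W)%E.
  rewrite (@sphere_integral_lin _ V (fun=> 0) W s (s ^+ 2))// ?sqr_ge0//.
    rewrite [X in (X + _)%E](_ : _ = 0%E) ?add0e//.
    by apply: integral0_eq => z _; rewrite !mul0r.
  by move=> x sx; rewrite /V sx add0r mulrC.
have EW : sphere_integral s W =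
    (sphere_integral s (sqnorm (tangential_part u)) + (s ^- 2)%:E * sphere_integral s A)%E.
  rewrite (@sphere_integral_lin _ W G A s (s ^- 2))// ?invr_ge0 ?sqr_ge0//.
    congr (_ + _)%E; apply: eq_integral => z _; congr EFin.
    by rewrite sqnorm_tangential_part// sq3_sph expf_neq0// gt_eqF.
  by move=> x sx; rewrite /G sx mulrC subrK.
rewrite EV; move: EW (sphere_integral_ge0 s A0).
set tau := sphere_integral s (sqnorm (tangential_part u)).
case: (sphere_integral s W) => [w| |]// + + _.
case: (sphere_integral s A) => [q| |]// + + _.
(* The left side of [EW] is finite, which rules out an infinite tangential integral. *)
rewrite -!EFinM lee_fin; case: tau => [tau| |]//; rewrite -EFinD => -[Ew] q0 dF dP dQ.
have sn0 : s != 0 by rewrite gt_eqF.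
have d2 : is_derive (s : R) 1 (fun y : R => y ^+ 2 * F y) (s ^+ 2 * w + F s * (2 * s)).
  have dX : is_derive (s : R) 1 (fun y : R => y ^+ 2) (2 * s).
    have -> : (fun y : R => y ^+ 2) = (id : R -> R) ^+ 2 by apply/funext => y; rewrite fctE.
    by apply: is_derive_eq; rewrite /GRing.scale/= expr1 mulr1.
  have -> : (fun y : R => y ^+ 2 * F y) = (fun y : R => y ^+ 2) * (F : R -> R) by [].
  exact: (is_deriveM dX dF).
have d3 : is_derive (s : R) 1 (fun y : R => 3 * P y - 4 * Q y)
    (3 * (s ^+ 2 * w) - 4 * q).
  have -> : (fun y : R => 3 * P y - 4 * Q y) = 3 *: (P : R -> R) - 4 *: (Q : R -> R) by [].
  exact: (is_deriveB (is_deriveZ 3 dP) (is_deriveZ 4 dQ)).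
(* [FPQ] holds for all [y > 0], hence near [s], so the two computed derivatives coincide. *)
have E : s ^+ 2 * w + F s * (2 * s) = 3 * (s ^+ 2 * w) - 4 * q.
  rewrite -[LHS](derive_val (is_derive := d2)) -[RHS](derive_val (is_derive := d3)).
  apply: near_eq_derive; near=> y; apply: FPQ.
  by near: y; exact: lt_nbhsr.
have := integrable_fin_num (measurable_ball3 s0) (iW _ s0) => /fineK <-.
rewrite -EFinM lee_fin -/(F s).
have FE : F s = s * w - 2 * (q / s).
  apply: (mulIf (_ : 2 * s != 0)); first by rewrite mulf_neq0.
  transitivity (2 * (s ^+ 2 * w) - 4 * q); first by lra.
  by field.
rewrite FE Ew.
have : 0 <= q / s by rewrite divr_ge0// ltW.
have -> : s * (tau + s ^- 2 * q) = s * tau + q / s by field.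
by lra.
Unshelve. all: by end_near.
Qed.

Lemma sqnorm_eq0_ae : (forall e : R, 0 < e -> (\int[leb]_(x in ball3 e) (W x)%:E = 0)%E) ->
  forall i, {ae leb, forall x : TTT, u i x = 0}.
Proof.
move=> H i.
have mW := measurable_sqnorm u2.
have Hn n : {ae leb, forall x : TTT, ball3 n.+1%:R x -> (W x)%:E = 0%E}.
  have n0 : 0 < n.+1%:R :> R by [].
  apply/ae_eq_integral_abs => //; first exact: measurable_ball3.
    by apply/measurable_EFinP; exact: measurable_funTS.
  under eq_integral do rewrite gee0_abs ?lee_fin ?sqnorm_ge0//.
  exact: H.
have := ae_foralln Hn; apply: filterS => x Hx.
have n0 : 0 <= norm3 x by exact: sqrtr_ge0.
have : (W x)%:E = 0%E.
  apply: (Hx (Num.bound (norm3 x))); rewrite /ball3 /=.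
  by rewrite (lt_trans (archi_boundP n0))// ltr_nat.
move=> [/eqP]; rewrite psumr_eq0 => [|k _]; last exact: sqr_ge0.
by move=> /allP/(_ i); rewrite mem_index_enum => /(_ isT); rewrite sqrf_eq0 => /eqP.
Qed.

End liouville.

Unset Implicit Arguments.
Set Strict Implicit.

(** Changing [u] on a null set can alter its sphere integrals at a null set of radii. Asking for a
    sequence outside each null set [N] makes the decay condition independent of the representative,
    and allows [N] to be the set of radii where [ae_energy_le_tangential] fails. *)
Theorem theorem1p3 (R : realType) (u : vfield R) :
  L2loc u ->
  weak_euler u (fun x => - (sqnorm u x / 2)) ->
  (forall r : R, 0 < r ->
     (\int[@leb3 R]_(x in ball3 r) (sqnorm (normal_part u) x / norm3 x)%:E
      <= (2 * r)^-1%:E * \int[@leb3 R]_(x in ball3 r) (sqnorm u x)%:E)%E) /\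
  ((forall N : set R, (@lebesgue_measure R).-negligible N ->
      exists Rk : nat -> R,
        (forall k, ~ N (Rk k)) /\
        Rk k @[k --> \oo] --> +oo /\
        sphere_integral (Rk k) (sqnorm (tangential_part u)) @[k --> \oo] --> 0%E) ->
   forall i, {ae @leb3 R, forall x, u i x = 0}).
Proof.
move=> u2 uE; split; first exact: normal_energy.
move=> H; have [Rk [NRk [Rky tau0]]] := H _ (ae_energy_le_tangential u2 uE).
apply: sqnorm_eq0_ae => // e e0.
have F0 : (0 <= \int[@leb3 R]_(x in ball3 e) (sqnorm u x)%:E)%E.
  by apply: integral_ge0 => x _; rewrite lee_fin sqnorm_ge0.
set c : R := e ^+ 2 * (2 * e ^+ 2) `^ (- (3 / 2)).
have c0 : 0 < c by rewrite mulr_gt0 ?exprn_gt0// powR_gt0// mulr_gt0// exprn_gt0.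
suff : (c%:E * \int[@leb3 R]_(x in ball3 e) (sqnorm u x)%:E <= 0)%E.
  rewrite pmule_rle0 ?lte_fin// => Fle; apply/le_anti; by rewrite Fle F0.
(* As soon as [Rk k >= e], the chain [c F e <= F (Rk k) / Rk k <=] tangential integral over the
   sphere of radius [Rk k] holds; its last member tends to 0. *)
apply: (cvge_ge _ tau0); near=> k.
have ek : e <= Rk k by near: k; move/cvgryPge: Rky; exact.
have Rk0 : 0 < Rk k by exact: lt_le_trans ek.
apply: (le_trans (energy_growth u2 uE e0 ek)).
have /contrapT/(_ Rk0) h := NRk k.
apply: (@le_trans _ _ ((Rk k)^-1%:E * ((Rk k)%:E * sphere_integral (Rk k) (sqnorm (tangential_part u))))%E).
  by apply: lee_wpmul2l => //; rewrite lee_fin invr_ge0 ltW.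
by rewrite muleA -EFinM mulVf ?gt_eqF// mul1e.
Unshelve. all: by end_near.
Qed.
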